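(* Let $n\ge2$ and let $\Sigma_1^{\mathsf{ant}}=S^1\times S^1\subseteq\mathbb{C}\times\mathbb{C}$ with the free $\mathbb{Z}_2$-action $\sigma(x',x'')=(-x',\overline{x''})$, whose quotient is the Klein bottle $K$. Then $\mathsf{TC}^{\mathbb{Z}_2}_{\mathsf{effl},n}(\Sigma_1^{\mathsf{ant}})=2n$.
   Context: For a finite group $G$ acting freely on $X$ with quotient $\pi:X\to X/G$: $M_n(X)$ is the space of $n$-tuples of paths $[0,1]\to X$ with a common starting point, $e_n:M_n(X)\to X^n$ is evaluation at $1$, and $\mathsf{TC}^G_{\mathsf{effl},n}(X)$ is the non-reduced sectional category of $(1\times\pi^{n-1})\circ e_n:M_n(X)\to X\times(X/G)^{n-1}$, i.e. the least number of open sets covering $X\times(X/G)^{n-1}$ each admitting a continuous section. *)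

(* Defs.v *)
From HB Require Import structures.
From mathcomp Require Import all_boot all_order all_algebra.
From mathcomp Require Import all_classical all_reals all_analysis.
From mathcomp Require Import generic_quotient.

Set Implicit Arguments.
Unset Strict Implicit.
Unset Printing Implicit Defensive.

Import Order.TTheory GRing.Theory Num.Theory.
Import numFieldNormedType.Exports.
Local Open Scope classical_set_scope.
Local Open Scope ring_scope.
Local Open Scope quotient_scope.

(* Sectional category (non-reduced).                                        *)
(* [p : E -> B] is a map of topological spaces, where the actual total space *)
(* is the subspace [M] of the ambient space [E] (subspace topology).         *)
Definition secat_cover {E B : topologicalType} (p : E -> B) (M : set E)
    (k : nat) : Prop :=
  exists U : 'I_k -> set B,
    (forall i, open (U i)) /\
    (\bigcup_(i in setT) U i = setT) /\
    (forall i, exists s : B -> E,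
        {within U i, continuous s} /\
        (forall b, U i b -> M (s b) /\ p (s b) = b)).

Definition secat_is {E B : topologicalType} (p : E -> B) (M : set E)
    (m : nat) : Prop :=
  secat_cover p M m /\ (forall k, secat_cover p M k -> (m <= k)%N).

Section EfflTC.
Variable R : realType.

Definition unitI : set R := [set t | 0 <= t <= 1].
Definition II : topologicalType := set_type unitI.

Lemma unitI0 : unitI 0. Proof. by rewrite /unitI /= lexx ler01. Qed.
Lemma unitI1 : unitI 1. Proof. by rewrite /unitI /= lexx ler01. Qed.
Definition I0 : II := exist _ 0 (mem_set unitI0).
Definition I1 : II := exist _ 1 (mem_set unitI1).

Definition pathsp (X : topologicalType) := {compact-open, II -> X}.

Variables (X : topologicalType) (sigma : X -> X).
Hypothesis sigmaK : involutive sigma.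

Definition orb_rel (x y : X) : bool := (y == x) || (y == sigma x).

Lemma orb_rel_refl : reflexive orb_rel.
Proof. by move=> x; rewrite /orb_rel eqxx. Qed.
Lemma orb_rel_sym : symmetric orb_rel.
Proof.
move=> x y; rewrite /orb_rel [y == x]eq_sym; congr (_ || _).
by apply/eqP/eqP => ->; rewrite sigmaK.
Qed.
Lemma orb_rel_trans : transitive orb_rel.
Proof.
move=> y x z; rewrite /orb_rel.
case/orP => /eqP -> /orP [] /eqP ->; rewrite ?sigmaK ?eqxx ?orbT //.
Qed.
Definition orb_equiv : equiv_rel X :=
  EquivRel orb_rel orb_rel_refl orb_rel_sym orb_rel_trans.

Definition orbsp := quotient_topology {eq_quot orb_equiv}.
Definition proj (x : X) : orbsp := \pi_orbsp x.

(* ambient space for M_n(X): the first path and the n-1 remaining paths *)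
Definition Mamb (n : nat) :=
  (pathsp X * {ptws 'I_n.-1 -> pathsp X})%type.
Definition Mbase (n : nat) := (X * {ptws 'I_n.-1 -> orbsp})%type.

Definition Mn (n : nat) : set (Mamb n) :=
  [set g | continuous (g.1 : II -> X) /\
           (forall j, continuous (g.2 j : II -> X)) /\
           (forall j, g.2 j I0 = g.1 I0)].

Definition effl_map (n : nat) (g : Mamb n) : Mbase n :=
  (g.1 I1, fun j => proj (g.2 j I1)).

Definition TC_effl_is (n m : nat) : Prop := secat_is (fun g : Mamb n => effl_map g) (@Mn n) m.

End EfflTC.

(* The torus Sigma_1^ant = S^1 x S^1 in C x C, with C identified with R x R *)
(* (z = a + bi <-> (a,b)), and sigma(x',x'') = (-x', conj x'').             *)
Section Torus.
Variable R : realType.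

Definition S1 : set (R * R) := [set z | z.1 ^+ 2 + z.2 ^+ 2 = 1].
Definition torus_set : set ((R * R) * (R * R)) := [set p | S1 p.1 /\ S1 p.2].
Definition torus : topologicalType := set_type torus_set.

Definition sigma_amb (p : (R * R) * (R * R)) : (R * R) * (R * R) :=
  ((- p.1.1, - p.1.2), (p.2.1, - p.2.2)).

Lemma sigma_amb_torus p : torus_set p -> torus_set (sigma_amb p).
Proof.
by case: p => [[a b] [c d]]; rewrite /torus_set /S1 /= !sqrrN.
Qed.

Definition sigma_ant (x : torus) : torus :=
  exist _ (sigma_amb (val x))
    (mem_set (sigma_amb_torus (set_mem (valP x)))).

Lemma sigma_antK : involutive sigma_ant.
Proof.
move=> [[[a b] [c d]] h]; apply/val_inj => /=.
by rewrite /sigma_amb /= !opprK.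
Qed.

End Torus.

(* Main.v *)
(** Rotating the first circle reduces the base X x K^(n-1) to C = S^1 x K^(n-1), a closed
    manifold of dimension 2n - 1.

    Upper bound: cut C open along the 2n - 1 seams x'' = 1, x' = +-y', y'' = 1 and stratify it
    by the set S of seams that the point is closest to.  Strata with equal |S| are disjoint and
    open, so they form 2n open sets, and over each stratum the points lift to explicit arcs.

    Lower bound: let z in H^1(S^1; Z/2) be the generator and b_j the class of the j-th Klein
    bottle that is 1 on the reversed circle and 0 on the glide reflection.  The lift of a square
    root of x'' along the paths of a local section trivializes every class z + b_j, while
    (z + b_1)^3 (z + b_2)^2 ... (z + b_(n-1))^2 = z b_1^2 ... b_(n-1)^2 is the top class, because
    b_j^2 <> 0, b_j^3 = 0 and z^2 = 0.  The cup product is computed on the face poset of a fine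
    cubical grid on the universal cover of C. *)
Require Import Defs.
From mathcomp Require Import all_boot all_order all_algebra generic_quotient.
From mathcomp Require Import all_classical all_reals all_analysis.
From mathcomp Require Import zify ring lra.
Set Implicit Arguments.
Unset Strict Implicit.
Unset Printing Implicit Defensive.
Import Order.TTheory GRing.Theory Num.Theory.
Import numFieldNormedType.Exports.
Local Open Scope ring_scope.

(** * Cochains on a cubical grid modulo 2 *)

(** No cohomology theory is built. A class in H^1(C; Z/2) is a character [chi] of the deck
    generators; a function [h] on the cells upstairs with [h (deck i p) = h p + chi i] represents
    it, and two representatives differ by an invariant function. Over the domain of a local section,
    the paths join x'' to y''_j through their common starting point and thus give a continuous
    square root of y''_j / x''. Upstairs x'' and y''_j have square roots of their own, and comparing
    the three yields a sign that flips exactly under the loops detected by z + b_j. This sign is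
    locally constant, so it represents the class with zero coboundary over that domain. Fewer than
    2n open sets can each be given their own factor of the product of 2n - 1 classes; on a grid
    finer than a Lebesgue number, every chain of cells then meets a vanishing factor. In the upper
    bound the obstacle is that a point of K has two lifts, and y' is known only up to sign. This is
    why the seam is x' = +-y', and why a lift is selected on each stratum before any arc is
    drawn. *)

Lemma addbool (b : bool) : b + b = 0 :> bool.
Proof. by case: b. Qed.

Lemma sum_bool_sym (I : finType) (g : I -> I -> bool) :
  (forall i j, g i j = g j i) -> (forall i, g i i = 0) ->
  \sum_i \sum_j g i j = 0.
Proof.
move=> gC g0.
pose lt (i j : I) := (enum_rank i < enum_rank j)%N.
have -> : \sum_i \sum_j g i j =
  \sum_i (\sum_(j | lt i j) g i j + \sum_(j | lt j i) g i j).
  apply: eq_bigr => i _; rewrite (bigID (lt i)) /=; congr (_ + _).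
  rewrite (bigD1 i) /=; last by rewrite /lt ltnn.
  rewrite g0 add0r; apply: eq_bigl => j; rewrite /lt -leqNgt ltn_neqAle andbC.
  by congr (_ && _); rewrite -(inj_eq (@enum_rank_inj I)).
rewrite big_split /= (exchange_big_dep xpredT) //=.
rewrite -[RHS](addbool (\sum_i \sum_(j | lt j i) g i j)); congr (_ + _).
by apply: eq_bigr => i _; apply: eq_bigr => j _.
Qed.

Definition evz (a : int) : bool := (2 %| a)%Z.

Lemma evzS a : evz (a + 1) = ~~ evz a. Proof. rewrite /evz; lia. Qed.
Lemma evzP a : evz (a - 1) = ~~ evz a. Proof. rewrite /evz; lia. Qed.

Section Lattice.
Variable I : finType.
Implicit Types (p : I -> int) (f g h : (I -> int) -> bool).

Definition shift_at (i : I) (e : int) p : I -> int :=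
  fun k => p k + (if k == i then e else 0).

Lemma shift_atC i j e e' p : shift_at i e (shift_at j e' p) = shift_at j e' (shift_at i e p).
Proof. by apply/funext => k; rewrite /shift_at addrAC. Qed.

Lemma shift_at_id i e p : shift_at i e p i = p i + e.
Proof. by rewrite /shift_at eqxx. Qed.

Lemma shift_at_neq i k e p : k != i -> shift_at i e p k = p k.
Proof. by rewrite /shift_at => /negbTE ->; rewrite addr0. Qed.

(* Cells of the cubical grid are points of [Z^I]: an even coordinate is a vertex, an odd one an
   open edge.  [bdA] is the incidence operator of the face poset modulo 2. *)
Definition bdA f : (I -> int) -> bool := fun p =>
  \sum_i (evz (p i) * (f (shift_at i 1 p) + f (shift_at i (-1) p))).

Lemma bdA_add f g : bdA (fun p => f p + g p) = fun p => bdA f p + bdA g p.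
Proof.
apply/funext => p; rewrite /bdA -big_split /=; apply: eq_bigr => i _.
by rewrite -mulrDr addrACA.
Qed.

Lemma bdA1 : bdA (fun=> 1) = fun=> 0.
Proof. by apply/funext => p; rewrite /bdA big1 // => i _; rewrite addbool mulr0. Qed.

Lemma bdA0 : bdA (fun=> 0) = fun=> 0.
Proof. by apply/funext => p; rewrite /bdA big1 // => i _; rewrite addbool mulr0. Qed.

(** A step in direction i makes the i-th coordinate odd, so no direction is used twice; two distinct
    directions are counted in both orders and cancel modulo 2. *)
Lemma bdAA f : bdA (bdA f) = fun=> 0.
Proof.
apply/funext => p; pose T i j : bool :=
  f (shift_at j 1 (shift_at i 1 p)) + f (shift_at j (-1) (shift_at i 1 p)) +
  (f (shift_at j 1 (shift_at i (-1) p)) + f (shift_at j (-1) (shift_at i (-1) p))).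
transitivity (\sum_i \sum_j ((i != j) : bool) * (evz (p i) * evz (p j) * T i j)).
  apply: eq_bigr => i _; rewrite /bdA -big_split /= mulr_sumr.
  apply: eq_bigr => j _; have [<-|ij] := eqVneq i j.
    rewrite !shift_at_id evzS evzP mul0r.
    by case: (evz (p i)) => /=; rewrite ?mul0r ?addr0 ?mulr0.
  by rewrite !shift_at_neq 1?eq_sym // mul1r -mulrDr mulrA.
apply: sum_bool_sym => [i j|i]; last by rewrite eqxx mul0r.
rewrite eq_sym [evz _ * _]mulrC; congr (_ * (_ * _)).
rewrite /T !(shift_atC j) addrACA; congr (_ + _); exact: addrC.
Qed.

(* The commutator [h, bdA] is incidence weighted by the coboundary of [h]; a product of
   such operators sums a cup product over the chains of the face poset. *)
Definition comm_op h f : (I -> int) -> bool :=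
  fun p => h p * bdA f p + bdA (fun q => h q * f q) p.

Lemma comm_opE h f p : comm_op h f p =
  \sum_i (evz (p i) * ((h p + h (shift_at i 1 p)) * f (shift_at i 1 p) +
                       (h p + h (shift_at i (-1) p)) * f (shift_at i (-1) p))).
Proof.
rewrite /comm_op /bdA mulr_sumr -big_split /=; apply: eq_bigr => i _.
by rewrite mulrCA -mulrDr; congr (_ * _); rewrite !mulrDl mulrDr addrACA.
Qed.

Lemma bdA_comm h f : bdA (comm_op h f) = comm_op h (bdA f).
Proof.
apply/funext => p; by rewrite /comm_op bdA_add; cbv beta; rewrite !bdAA addr0 mulr0 add0r.
Qed.

Lemma comm_op_addr h f g :
  comm_op h (fun p => f p + g p) = fun p => comm_op h f p + comm_op h g p.
Proof.
apply/funext => p; rewrite /comm_op bdA_add; cbv beta; rewrite mulrDr.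
have -> : (fun q => h q * (f q + g q)) = fun q => h q * f q + h q * g q.
  by apply/funext => q; rewrite mulrDr.
by rewrite bdA_add; cbv beta; rewrite addrACA.
Qed.

Lemma comm_op_addl h g f :
  comm_op (fun p => h p + g p) f = fun p => comm_op h f p + comm_op g f p.
Proof.
apply/funext => p; rewrite /comm_op mulrDl.
have -> : (fun q => (h q + g q) * f q) = fun q => h q * f q + g q * f q.
  by apply/funext => q; rewrite mulrDl.
by rewrite bdA_add; cbv beta; rewrite addrACA.
Qed.

Variable M : nat.
Hypothesis M_even : ~~ odd M.
Hypothesis M_gt0 : (0 < M)%N.
(* The deck transformations of the universal cover of [C], acting on the grid of mesh 1/M. *)
Variable refl : I -> option I.
Hypothesis reflP : forall i l, refl i = Some l -> (l != i) && (refl l == None).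

Definition deck (i : I) p : I -> int :=
  fun k => (if refl i == Some k then - p k else p k) +
           (if k == i then M%:Z else 0).

Lemma deck_shift i k e p :
  deck i (shift_at k e p) = shift_at k (if refl i == Some k then - e else e) (deck i p).
Proof.
apply/funext => l; rewrite /deck /shift_at.
have [->|kl] := eqVneq l k; last by rewrite !addr0.
by case: ifP => _; case: ifP => _; lia.
Qed.

Lemma deck_ev i p k : evz (deck i p k) = evz (p k).
Proof.
rewrite /deck /evz; case: ifP => _; case: ifP => _; rewrite ?addr0; lia.
Qed.

Definition deck_inv f := forall i p, f (deck i p) = f p.

Lemma bdA_deck f i p : bdA f (deck i p) = bdA (fun q => f (deck i q)) p.
Proof.
rewrite /bdA; apply: eq_bigr => k _; rewrite deck_ev !deck_shift.
by case: ifP => _ //; rewrite opprK [in RHS]addrC.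
Qed.

Lemma bdA_inv f : deck_inv f -> deck_inv (bdA f).
Proof. 
move=> fi i p; rewrite bdA_deck.
by have -> : (fun q => f (deck i q)) = f by apply/funext.
 Qed.

(** The commutator sees [h] only through its differences, which the constant [chi i] does not
    change. *)
Lemma comm_op_inv (chi : I -> bool) h f :
  (forall i p, h (deck i p) = h p + chi i) -> deck_inv f -> deck_inv (comm_op h f).
Proof.
move=> hc fi i p; rewrite /comm_op (bdA_inv fi) hc bdA_deck.
have -> : (fun q => h (deck i q) * f (deck i q)) =
    fun q => h q * f q + (chi i) * f q.
  by apply/funext => q; rewrite hc fi mulrDl.
rewrite bdA_add; cbv beta; rewrite mulrDl.
have -> : bdA (fun p0 => chi i * f p0) p = chi i * bdA f p.
  rewrite /bdA mulr_sumr; apply: eq_bigr => k _.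
  by rewrite -mulrDr mulrCA.
by rewrite addrACA addbool addr0.
Qed.

Definition box_pt (x : {ffun I -> 'I_M}) : I -> int := fun k => (x k)%:Z.

(** The box is a fundamental domain for the deck transformations. On a product of as many cochains
    as there are directions, this sum is the cup product evaluated on the fundamental class. *)
Definition box_sum f : bool := \sum_(x : {ffun I -> 'I_M}) f (box_pt x).

(** Stokes on a closed manifold: in direction k the cell below x is the cell above x - 2 e_k, and at
    the wall x_k = 0 the latter re-enters the box through [deck k]. *)
Lemma box_sum_bdA f : deck_inv f -> box_sum (bdA f) = 0.
Proof.
move=> fi; rewrite /box_sum /bdA exchange_big /= big1 // => k _.
under eq_bigr do rewrite mulrDr.
rewrite big_split /= -[RHS](addbool (\sum_(x : {ffun I -> 'I_M})
  evz (box_pt x k) * f (shift_at k 1 (box_pt x)))); congr (_ + _).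
have mlt a : (a %% M < M)%N by rewrite ltn_mod.
(* For even x_k, [phi x] is the representative in the box of x - 2 e_k: at x_k = 0 it wraps to M - 2
   and, if [refl k] is l, replaces x_l by - x_l modulo M. *)
pose phi (x : {ffun I -> 'I_M}) : {ffun I -> 'I_M} := [ffun l =>
  if l == k then Ordinal (mlt (x k + (M - 2))%N)
  else if (refl k == Some l) && (x k == 0 :> nat) then Ordinal (mlt (M - x l)%N)
  else x l].
have M2 : (2 <= M)%N by case: M M_gt0 M_even => [|[]].
have modI a b : (a < M)%N -> (b < M)%N -> ((a + (M - 2)) %% M = (b + (M - 2)) %% M)%N -> a = b.
  move=> aM bM /eqP; rewrite eqn_modDr !modn_small //; by move/eqP.
have phi_inj : injective phi.
  move=> x y xy; have xyk : x k = y k.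
    have := congr1 (fun z : {ffun I -> 'I_M} => val (z k)) xy; rewrite !ffunE eqxx /=.
    by move=> /modI e; apply/val_inj/e.
  apply/ffunP => l; have [->//|lk] := eqVneq l k.
  have := congr1 (fun z : {ffun I -> 'I_M} => val (z l)) xy.
  rewrite !ffunE (negbTE lk) xyk; case: ifP => [_ /= e|_ /val_inj//].
  apply/val_inj => /=; move: e; have := ltn_ord (x l); have := ltn_ord (y l).
  move: (val (x l)) (val (y l)) => a b bM aM.
  case: a aM => [|a] aM; case: b bM => [|b] bM //; rewrite ?subn0 ?modnn ?(@modn_small (M - _)) //; lia.
rewrite [RHS](reindex_inj phi_inj) /=; apply: eq_bigr => x _.
have phik : phi x k = ((x k + (M - 2)) %% M)%N :> nat by rewrite ffunE eqxx.
have phiev : evz (box_pt (phi x) k) = evz (box_pt x k).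
  rewrite /box_pt phik /evz.
  have := divn_eq (x k + (M - 2)) M; set a := (_ %% _)%N; move: (_ %/ _)%N => d.
  have Me : M = (2 * M./2)%N by rewrite mul2n even_halfK.
  move: (nat_of_ord (x k)) M2 => b; 
  move: (M./2)%N Me => c Me M2; rewrite Me => e.
  have : (b + 2 * c = (d * c) * 2 + a + 2)%N by lia.
  by move: (d * c)%N; lia.
rewrite phiev; case xe: (evz _) => //=; rewrite !mul1r.
have [x0|x0] := eqVneq (x k : nat) 0%N; last first.
  congr f; apply/funext => l; rewrite /shift_at /box_pt ffunE.
  have [->|lk] := eqVneq l k; last by rewrite (negbTE x0) andbF.
  have: (2 <= x k)%N.
    by move: xe x0; rewrite /box_pt /evz; case: (val (x k)) => [|[]].
  have := ltn_ord (x k) => /= /[swap] x2 xM.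
  have -> : (x k + (M - 2) = (x k - 2) + M)%N by lia.
  by rewrite modnDr modn_small; lia.
rewrite -(fi k).
have key l : l != k -> refl k != Some l ->
    deck k (shift_at k (-1) (box_pt x)) l = shift_at k 1 (box_pt (phi x)) l.
  move=> lk rl; rewrite /deck (negbTE rl) (negbTE lk) !shift_at_neq //.
  by rewrite addr0 /box_pt ffunE (negbTE lk) (negbTE rl).
have keyk : deck k (shift_at k (-1) (box_pt x)) k = shift_at k 1 (box_pt (phi x)) k.
  rewrite /deck !shift_at_id eqxx /box_pt phik x0 add0n modn_small; last by lia.
  case: ifP => [/eqP/reflP|_]; [by rewrite eqxx|lia].
case rk: (refl k) => [l|]; last first.
  congr f; apply/funext => l; have [->//|lk] := eqVneq l k.
  by apply: key; rewrite ?rk.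
have /andP[lk /eqP rl] := reflP rk.
have [xl|xl] := eqVneq (x l : nat) 0%N.
  congr f; apply/funext => j; have [->//|jk] := eqVneq j k.
  have [->|jl] := eqVneq j l; last by apply: key; rewrite // rk; apply/eqP => -[] /esym/eqP; rewrite (negbTE jl).
  rewrite /deck rk eqxx (negbTE lk) !shift_at_neq // /box_pt ffunE (negbTE lk) rk x0 eqxx /=.
  by rewrite xl subn0 modnn.
(* [deck k] has turned x_l > 0 into - x_l; the translation [deck l] moves it back into the box, to M
   - x_l. *)
rewrite -(fi l); congr f; apply/funext => j; rewrite {1}/deck rl /=.
have [->|jl] := eqVneq j l; last first.
  rewrite addr0; have [->//|jk] := eqVneq j k.
  by apply: key; rewrite // rk; apply/eqP => -[] /esym/eqP; rewrite (negbTE jl).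
rewrite /deck rk eqxx (negbTE lk) !shift_at_neq // /box_pt ffunE (negbTE lk) rk x0 !eqxx /=.
have := ltn_ord (x l); rewrite modn_small; lia.
Qed.

Definition comm_list (hs : seq ((I -> int) -> bool)) : (I -> int) -> bool :=
  foldr comm_op (fun=> 1) hs.

Lemma bdA_comm_list hs : bdA (comm_list hs) = fun=> 0.
Proof.
elim: hs => [|h hs IH] /=; first exact: bdA1.
rewrite bdA_comm IH; apply/funext => p; rewrite /comm_op bdA0 mulr0 add0r.
have -> : (fun q => h q * 0) = fun=> 0 by apply/funext => q; rewrite mulr0.
by rewrite bdA0.
Qed.

Definition same_char h h' := exists chi : I -> bool,
  (forall i p, h (deck i p) = h p + chi i) /\ (forall i p, h' (deck i p) = h' p + chi i).

(** The cup product is well defined on classes: [g = h t + h' t] is invariant, and the product of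
    the later factors is a cycle, so its commutator with [g] is the boundary of [g] times that
    product. *)
Lemma comm_list_cohom (T : Type) (s : seq T) (h h' : T -> (I -> int) -> bool) :
  (forall t, same_char (h t) (h' t)) ->
  deck_inv (comm_list (map h' s)) /\
  exists w, deck_inv w /\
    comm_list (map h s) = fun p => comm_list (map h' s) p + bdA w p.
Proof.
move=> hh'; elim: s => [|t s [inv' [w [wi IH]]]] /=.
  split=> //; exists (fun=> 0); split=> //.
  by apply/funext => p; rewrite bdA0 addr0.
have [chi [hc hc']] := hh' t.
pose g : (I -> int) -> bool := fun p => h t p + h' t p.
have gi : deck_inv g by move=> i p; rewrite /g hc hc' addrACA addbool addr0.
split; first exact: comm_op_inv hc' inv'.
exists (fun p => g p * comm_list (map h' s) p + comm_op (h t) w p); split.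
  move=> i p; rewrite gi inv'; congr (_ + _).
  exact: (comm_op_inv hc wi).
rewrite IH comm_op_addr bdA_add bdA_comm.
have -> : h t = fun p => h' t p + g p.
  by apply/funext => p; rewrite /g addrCA addbool addr0.
apply/funext => p; rewrite [RHS]addrA; apply: (congr1 (GRing.add^~ _)).
rewrite comm_op_addl; apply: (congr1 (GRing.add _)).
by rewrite /comm_op bdA_comm_list mulr0 add0r.
Qed.

Lemma box_sum_comm_list (T : Type) (s : seq T) (h h' : T -> (I -> int) -> bool) :
  (forall t, same_char (h t) (h' t)) ->
  box_sum (comm_list (map h s)) = box_sum (comm_list (map h' s)).
Proof.
move=> hh'; have [_ [w [wi ->]]] := comm_list_cohom s hh'.
have := box_sum_bdA wi; rewrite /box_sum => w0.
by rewrite big_split /= w0 addr0.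
Qed.

End Lattice.

(** * The top product of the classes z + b_j on the grid of C *)

Section KleinLattice.
Variables (J : finType) (M : nat).
Hypothesis M_even : ~~ odd M.
Hypothesis M_gt0 : (0 < M)%N.

(** [cr] is the angle r of x''; [cs j] and [ct j] are the coordinates s and t of the j-th Klein
    bottle, where the glide in s reverses t. *)
Definition cell_idx := option (J * bool).
Definition cr : cell_idx := None.
Definition cs (j : J) : cell_idx := Some (j, false).
Definition ct (j : J) : cell_idx := Some (j, true).

Definition klein_refl (i : cell_idx) : option cell_idx :=
  if i is Some (j, false) then Some (ct j) else None.

Lemma klein_reflP i l : klein_refl i = Some l -> (l != i) && (klein_refl l == None).
Proof.
case: i => [[j []]|] //= [<-] /=.
by rewrite andbT /ct; apply/eqP => -[].
Qed.

Definition parq (a : int) : bool := ~~ (2 %| (a %/ M%:Z)%Z)%Z.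
Definition dvM (a : int) : bool := (M%:Z %| a)%Z.

Let decomp a : exists d r : int, 0 <= r < M%:Z /\ a = d * M%:Z + r.
Proof.
exists (a %/ M%:Z)%Z, (a %% M%:Z)%Z; rewrite -divz_eq; split=> //.
rewrite modz_ge0 ?ltz_pmod //; lia.
Qed.

Let parq_val (d r : int) : 0 <= r < M%:Z -> parq (d * M%:Z + r) = ~~ (2 %| d)%Z.
Proof.
move=> hr; rewrite /parq divzDl ?dvdz_mull// mulzK; last by lia.
by rewrite divz_small ?addr0 //; lia.
Qed.

Let dvM_val (d r : int) : 0 <= r < M%:Z -> dvM (d * M%:Z + r) = (r == 0).
Proof.
move=> hr; rewrite /dvM rpredDl ?dvdz_mull//.
apply/idP/eqP => [/dvdzP[q rq]|->]; last exact: dvdz0.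
have : q = 0 by nia.
by move=> q0; rewrite rq q0 mul0r.
Qed.

Let M2 : exists c : int, M%:Z = 2 * c /\ 0 < c.
Proof. by exists (M./2)%:Z; have := odd_double_half M; lia. Qed.

Lemma addb1 (b : bool) : b + 1 = ~~ b.
Proof. by case: b. Qed.

Lemma parqDM a : parq (a + M%:Z) = parq a + 1.
Proof.
have [d [r [hr ->]]] := decomp a.
have -> : d * M%:Z + r + M%:Z = (d + 1) * M%:Z + r by ring.
by rewrite !parq_val // addb1; lia.
Qed.

Lemma parqBM a : parq (a - M%:Z) = parq a + 1.
Proof. by rewrite -[in RHS](subrK M%:Z a) parqDM -addrA addbool addr0. Qed.

Lemma parqS a : evz a -> parq (a + 1) = parq a.
Proof.
have [d [r [hr ->]]] := decomp a; have [c [Mc c0]] := M2 => ev.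
have r1 : 0 <= r + 1 < M%:Z.
  move: ev hr; rewrite /evz Mc mulrCA rpredDl ?dvdz_mulr// => /dvdzP[b ->].
  by lia.
by rewrite -addrA !parq_val.
Qed.

Lemma parqP a : parq (a - 1) = parq a + dvM a.
Proof.
have [d [r [hr ->]]] := decomp a.
rewrite parq_val // dvM_val //; have [->|r0] := eqVneq r 0.
  have -> : d * M%:Z + 0 - 1 = (d - 1) * M%:Z + (M%:Z - 1) by ring.
  by rewrite parq_val ?addb1; lia.
by rewrite -addrA parq_val ?addr0; lia.
Qed.

Lemma parqN a : parq (- a) = parq a + ~~ dvM a.
Proof.
have [d [r [hr ->]]] := decomp a.
rewrite parq_val // dvM_val //; have [->|r0] := eqVneq r 0.
  have -> : - (d * M%:Z + 0) = (- d) * M%:Z + 0 by ring.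
  by rewrite parq_val ?addr0; lia.
have -> : - (d * M%:Z + r) = (- d - 1) * M%:Z + (M%:Z - r) by ring.
by rewrite parq_val ?addb1; lia.
Qed.

Lemma dvMev a : dvM a -> evz a.
Proof.
have [c [Mc c0]] := M2.
rewrite /dvM /evz Mc => /dvdzP[q ->]; apply/dvdzP; exists (q * c); ring.
Qed.

Lemma dvMS a : dvM a -> dvM (a + 1) = false.
Proof.
move=> /dvMev ev; apply/negP => /dvMev; by rewrite evzS ev.
Qed.

Lemma dvMP a : dvM a -> dvM (a - 1) = false.
Proof.
move=> /dvMev ev; apply/negP => /dvMev; by rewrite evzP ev.
Qed.

Lemma dvMN a : dvM (- a) = dvM a.
Proof. by rewrite /dvM !dvdzE abszN. Qed.

(* The deck transformation [s += M] reverses [t]; reading [t] with the sign given by the parity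
   of the sheet of [s] makes the cochain invariant under it. *)
Definition std_cochain (j : J) (p : cell_idx -> int) : bool :=
  parq (p cr) + (if parq (p (cs j)) then parq (- p (ct j)) else parq (p (ct j))).

(** The side of a wall t = 0 mod M on which [std_cochain] jumps: between t - 1 and t when [parq t]
    is read, between t and t + 1 when [parq (- t)] is read. *)
Definition tdir (j : J) (p : cell_idx -> int) : int := if parq (p (cs j)) then 1 else -1.

Lemma cs_ct j k : cs j != ct k.
Proof. by apply/eqP => -[]. Qed.

Lemma ct_cs j k : ct j != cs k.
Proof. by apply/eqP => -[]. Qed.

(** The coboundary lives on the walls r = 0 and t = 0 modulo M, and on s = 0 where the change from
    reading t to reading - t alters the parity, which by [parqN] happens exactly off t = 0. *)
Lemma comm_std j f p : comm_op (std_cochain j) f p =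
  dvM (p cr) * f (shift_at cr (-1) p) +
  dvM (p (ct j)) * f (shift_at (ct j) (tdir j p) p) +
  dvM (p (cs j)) * ~~ dvM (p (ct j)) * f (shift_at (cs j) (-1) p).
Proof.
have := cs_ct j j; have := ct_cs j j => nts nst.
rewrite comm_opE (bigD1 cr) // (bigD1 (ct j)) // (bigD1 (cs j)); last by rewrite nst.
rewrite big1; first rewrite Monoid.mulm1.
  rewrite -[RHS]addrA; congr (_ + (_ + _)).
  - rewrite /std_cochain !shift_at_id !shift_at_neq // parqP.
    case: (boolP (evz _)) => [ev|nev]; last first.
      by rewrite mul0r; case: (boolP (dvM _)) => [/dvMev/(negP nev)//|]; rewrite mul0r.
    rewrite (parqS ev) mul1r addbool mul0r add0r; congr (_ * _).
    by case: parq; case: dvM; case: ifP => _; case: parq.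
  - rewrite /std_cochain /tdir !shift_at_id !shift_at_neq //.
    case: (boolP (evz _)) => [ev|nev]; last first.
      by rewrite mul0r; case: (boolP (dvM _)) => [/dvMev/(negP nev)//|]; rewrite mul0r.
    have ev' : evz (- p (ct j)) by move: ev; rewrite /evz !dvdzE abszN.
    rewrite mul1r; case: (parq (p (cs j))).
      rewrite opprD opprB [1 - _]addrC (parqS ev') addbool mul0r addr0 parqP dvMN; congr (_ * _).
      by case: (parq (p cr)); case: parq; case: dvM.
    rewrite (parqS ev) addbool mul0r add0r parqP; congr (_ * _).
    by case: (parq (p cr)); case: parq; case: dvM.
  rewrite /std_cochain !shift_at_id !shift_at_neq //.
  case: (boolP (evz _)) => [ev|nev]; last first.
    rewrite mul0r; case: (boolP (dvM (p (cs j)))) => [/dvMev/(negP nev)//|].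
    by [].
  rewrite mul1r (parqS ev) addbool mul0r add0r parqP parqN; congr (_ * _).
  by case: (parq (p (cs j))); case: (parq (p cr)); case: (dvM (p (cs j))); case: (parq (p (ct j))); case: dvM.
move=> i /andP[/andP[/andP[_ icr] ict] ics]; rewrite /std_cochain !shift_at_neq 1?eq_sym //.
by rewrite !addbool ?mul0r ?addr0 mulr0.
Qed.

(** This identifies the class as z + b_j. Under the glide in s_j the reversal of t_j cancels against
    the change of reading. *)
Lemma std_cochain_deck j i p :
  std_cochain j (deck M klein_refl i p) = std_cochain j p + ((i == cr) || (i == ct j)).
Proof.
have ctE k l : (ct k == ct l) = (k == l) by apply/eqP/eqP => [[]|->].
have csE k l : (cs k == cs l) = (k == l) by apply/eqP/eqP => [[]|->].
have SE (x y : cell_idx) : (Some x == Some y) = (x == y) by [].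
have scE k l : (cs k == ct l) = false by apply/negbTE/cs_ct.
have tsE k l : (ct k == cs l) = false by apply/negbTE/ct_cs.
have rt k : klein_refl (ct k) = None by [].
have rs k : klein_refl (cs k) = Some (ct k) by [].
case: i => [[k []]|].
- rewrite -/(ct k) /std_cochain /deck rt ?ctE ?scE ?tsE ?addr0 orFb [j == k]eq_sym /=.
  case: eqP => _; rewrite ?addr0 // opprD parqDM parqBM -[RHS]addrA.
  by case: ifP.
- rewrite -/(cs k) /std_cochain /deck rs ?SE ?ctE ?csE ?scE ?tsE ?addr0 [j == k]eq_sym.
  case: eqP => _; rewrite ?addr0 //.
  rewrite parqDM opprK addb1; by case: (parq (p (cs j))); rewrite /= ?addr0.
- rewrite /std_cochain /deck /cr /= ?addr0 parqDM.
  by case: (parq (p None)); case: ifP => _; case: (parq _).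
Qed.

Definition local_const (j : J) (F : (cell_idx -> int) -> bool) :=
  forall p e, F (shift_at (cs j) e p) = F p /\ F (shift_at (ct j) e p) = F p.

(** The source of b_j^2 <> 0: stepping off the wall t = 0 activates the wall s = 0, so the order t,
    s survives, whereas s, t is excluded because the s wall omits t = 0. Mixed pairs with r occur in
    both orders and cancel, and no wall is crossed twice since a step leaves it. *)
Lemma comm_std_twice j F : local_const j F ->
  comm_op (std_cochain j) (comm_op (std_cochain j) F) =
  fun p => dvM (p (cs j)) * dvM (p (ct j)) * F p.
Proof.
have := cs_ct j j; have := ct_cs j j => nts nst.
move=> lF; apply/funext => p; rewrite 4!comm_std.
rewrite (shift_atC cr (ct j)) (shift_atC cr (cs j)).
rewrite !(proj1 (lF _ _)) !(proj2 (lF _ _)) !shift_at_id !shift_at_neq //.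
rewrite /tdir.
have e1 a : dvM a * dvM (a - 1) = false by case: (boolP (dvM a)) => [/dvMP ->|].
have e2 a : dvM a * dvM (a + (if parq (p (cs j)) then 1 else -1)) = false.
  by case: (boolP (dvM a)) => [h|] //; case: ifP => _; rewrite ?(dvMP h) ?(dvMS h).
have := e1 (p cr); have := e1 (p (cs j)); have := e2 (p (ct j)).
move: (dvM (p cr)) (dvM (p (cs j))) (dvM (p (ct j))) (dvM (p cr - 1))
  (dvM (p (cs j) - 1)) (dvM (p (ct j) + _)) (F p) (F (shift_at cr _ p)) (F (shift_at cr _ (shift_at cr _ p))).
by do 9 case.
Qed.

Lemma local_const_dvM j (s : seq J) : j \notin s ->
  local_const j (fun p => \prod_(k <- s) (dvM (p (cs k)) * dvM (p (ct k)))).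
Proof.
move=> js p e; split; apply: eq_big_seq => k ks;
  have kj : k != j by [apply: contraNneq js => <-].
- by rewrite !shift_at_neq ?ct_cs //; apply: contra kj => /eqP[->].
- by rewrite !shift_at_neq ?cs_ct //; apply: contra kj => /eqP[->].
Qed.

Definition cochain_idx (j0 : J) : seq J :=
  j0 :: flatten [seq [:: j; j] | j <- enum J].

Lemma size_cochain_idx j0 : size (cochain_idx j0) = (#|J|.*2).+1.
Proof.
rewrite /= size_flatten /shape -map_comp cardE; congr _.+1.
by elim: (enum J) => //= x s ->.
Qed.

Lemma comm_list_std j0 :
  comm_list (map std_cochain (cochain_idx j0)) =
  fun p => dvM (p cr) * \prod_(k <- enum J) (dvM (p (cs k)) * dvM (p (ct k))).
Proof.
have IH (s : seq J) : uniq s ->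
    comm_list (map std_cochain (flatten [seq [:: j; j] | j <- s])) =
    fun p => \prod_(k <- s) (dvM (p (cs k)) * dvM (p (ct k))).
  elim: s => [_|j s IH] /=; first by apply/funext => p; rewrite big_nil.
  move=> /andP[js us]; 
  rewrite -/(comm_list [seq std_cochain i | i <- flatten [seq [:: j; j] | j <- s]]).
  rewrite (IH us) comm_std_twice.
    by apply/funext => p; rewrite big_cons.
  exact: local_const_dvM.
rewrite /= -/(comm_list [seq std_cochain i | i <- flatten [seq [:: j; j] | j <- enum J]]).
rewrite (IH _ (enum_uniq _)); apply/funext => p.
rewrite comm_std.
have nts := ct_cs j0 j0; have nst := cs_ct j0 j0.
(* The leading factor could also cross the walls of t or s for [j0], but the remaining product is
   supported on both of them and the step leaves one: this is b_j^3 = 0. *)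
have -> : dvM (p (ct j0)) * \prod_(k <- enum J)
    (dvM (shift_at (ct j0) (tdir j0 p) p (cs k)) * dvM (shift_at (ct j0) (tdir j0 p) p (ct k))) = 0.
  rewrite (bigD1_seq j0) ?mem_enum ?enum_uniq // shift_at_id.
  case: (boolP (dvM (p (ct j0)))) => [h|]; last by rewrite mul0r.
  by rewrite /tdir; case: ifP => _; rewrite ?(dvMP h) ?(dvMS h) mulr0.
have -> : dvM (p (cs j0)) * ~~ dvM (p (ct j0)) * \prod_(k <- enum J)
    (dvM (shift_at (cs j0) (-1) p (cs k)) * dvM (shift_at (cs j0) (-1) p (ct k))) = 0.
  rewrite (bigD1_seq j0) ?mem_enum ?enum_uniq // shift_at_id.
  case: (boolP (dvM (p (cs j0)))) => [h|]; last by rewrite !mul0r.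
  rewrite (dvMP h); exact: (mulr0 (true * ~~ dvM (p (ct j0)))).
rewrite !addr0; congr (_ * _); apply: eq_bigr => k _.
by rewrite !shift_at_neq.
Qed.

(** The origin is the only point of the box with all coordinates divisible by M. *)
Lemma box_sum_std j0 : @box_sum cell_idx M (comm_list (map std_cochain (cochain_idx j0))) = 1.
Proof.
have d0 : dvM 0 = true by rewrite /dvM dvdz0.
rewrite comm_list_std /box_sum (bigD1 [ffun=> Ordinal M_gt0]) //.
have -> : @box_pt cell_idx M [ffun=> Ordinal M_gt0] = fun=> 0.
  by apply/funext => i; rewrite /box_pt ffunE.
cbv beta; rewrite d0 big1 // big1 ?Monoid.mulm1 //.
move=> x /andP[_ /eqP xn]; case nz: (_ * _) => //; case: xn.
have h a : (a < M)%N -> dvM a -> a = 0%N.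
  by move=> aM; rewrite /dvM dvdzE /= => d; apply/eqP; move: d; rewrite /dvdn modn_small.
apply/ffunP => i; rewrite ffunE; apply/val_inj => /=; apply: h => //.
have /andP[hr] : is_true (dvM (box_pt x cr) && _) := nz.
case: i => [[j b]|] // {}nz.
move: nz; rewrite (bigD1_seq j) ?mem_enum ?enum_uniq // => nz.
have /andP[/andP[hs ht] _] : is_true ((dvM (box_pt x (cs j)) && dvM (box_pt x (ct j))) && _) := nz.
by case: b.
Qed.

Definition cell_near (r : nat) (p q : cell_idx -> int) := forall i, `|q i - p i| <= r%:Z.

(** Factor l contributes its increment along a step that starts within distance l of [p]. *)
Lemma comm_list_local (hs : seq ((cell_idx -> int) -> bool)) l p :
  (l < size hs)%N ->
  (forall q, cell_near (size hs) p q -> forall i e, `|e| = 1 ->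
     nth (fun=> 0) hs l (shift_at i e q) = nth (fun=> 0) hs l q) ->
  comm_list hs p = 0.
Proof.
(* [d] bounds the distance walked from [p] to [q]; passing a factor raises it by one and lowers l by
   one, so the radius d + l is constant. *)
suff gen q d : (l < size hs)%N ->
    (forall q, cell_near (d + l) p q -> forall i e, `|e| = 1 ->
     nth (fun=> 0) hs l (shift_at i e q) = nth (fun=> 0) hs l q) ->
    cell_near d p q -> comm_list hs q = 0.
  move=> ls hl; apply: (gen p 0%N) => //; last by move=> i; rewrite subrr normr0.
  move=> q hq; apply: hl => i; apply: le_trans (hq i) _; rewrite add0n; lia.
elim: hs l q d => // h hs IH [|l] q d ls hl hq; rewrite /comm_list /= -/(comm_list hs) comm_opE big1 // => i _.
  rewrite addn0 in hl; move/(_ q hq i): (hl) => /= hi.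
  by rewrite !hi ?normrN1 ?normr1 // !addbool ?mul0r ?mulr0.
have zero e : `|e| = 1 -> comm_list hs (shift_at i e q) = 0.
  move=> e1; apply: (IH l _ d.+1) => //; first by move=> q' hq'; apply: hl; rewrite addnS -addSn.
  move=> k; rewrite /shift_at; case: ifP => _; have := hq k; rewrite ?addr0; lia.
by rewrite !zero ?normrN1 ?normr1 // !mulr0.
Qed.

(* Analogue of Tucker's lemma: a cochain that is constant near [box_pt x] kills every chain
   starting there, so the hypothesis would annihilate the nonzero cup product. *)
Lemma klein_tucker (j0 : J) (h : J -> nat -> (cell_idx -> int) -> bool) :
  (forall j l, same_char M klein_refl (std_cochain j) (h j l)) ->
  ~ (forall x : {ffun cell_idx -> 'I_M}, exists2 l, (l < (#|J|.*2).+1)%N &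
     forall j q, cell_near (#|J|.*2).+1 (box_pt x) q ->
     forall i e, `|e| = 1 -> h j l (shift_at i e q) = h j l q).
Proof.
(* Tagging each factor with its position lets factor l use the cochain adapted to the l-th open
   set. *)
move=> hh loc; pose s := zip (cochain_idx j0) (iota 0 (#|J|.*2).+1).
have szs : size s = (#|J|.*2).+1 by rewrite size_zip size_cochain_idx size_iota minnn.
have := box_sum_std j0.
have -> : map std_cochain (cochain_idx j0) = map (fun t : J * nat => std_cochain t.1) s.
  rewrite [RHS](map_comp std_cochain fst); congr map.
  by rewrite -/(unzip1 _) unzip1_zip // size_cochain_idx size_iota.
rewrite (box_sum_comm_list M_even M_gt0 klein_reflP s (h' := fun t => h t.1 t.2)) => [|t]; last exact: hh.
rewrite /box_sum big1 // => x _.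
have [l ls hl] := loc x; apply: (@comm_list_local _ l); rewrite size_map szs //.
move=> q hq i e e1; rewrite !(nth_map (j0, 0%N)) ?szs //.
rewrite nth_zip ?size_cochain_idx ?size_iota // nth_iota // add0n.
exact: hl.
Qed.

End KleinLattice.

Local Open Scope classical_set_scope.
Local Open Scope quotient_scope.
Local Open Scope ring_scope.

(** * Unit complex numbers as pairs of reals *)

Section Plane.
Variable R : realType.
Implicit Types z w : (R * R)%type.

Definition cmul z w : R * R := (z.1 * w.1 - z.2 * w.2, z.1 * w.2 + z.2 * w.1).
Definition conjc z : R * R := (z.1, - z.2).
Definition oppc z : R * R := (- z.1, - z.2).
Definition dot z w : R := z.1 * w.1 + z.2 * w.2.
(* The square root with positive real part, for unit [z <> -1]. *)
Definition sqrtc z : R * R :=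
  let d := Num.sqrt (2 + 2 * z.1) in ((1 + z.1) / d, z.2 / d).

Lemma cmulC z w : cmul z w = cmul w z.
Proof. by rewrite /cmul; congr pair; ring. Qed.

Lemma cmulA z w u : cmul z (cmul w u) = cmul (cmul z w) u.
Proof. by rewrite /cmul /=; congr pair; ring. Qed.

Lemma S1_cmul z w : S1 z -> S1 w -> S1 (cmul z w).
Proof.
rewrite /S1 /= => hz hw.
transitivity ((z.1 ^+ 2 + z.2 ^+ 2) * (w.1 ^+ 2 + w.2 ^+ 2)); first ring.
by rewrite hz hw mulr1.
Qed.

Lemma S1_conj z : S1 z -> S1 (conjc z).
Proof. by rewrite /S1 /= sqrrN. Qed.

Lemma cmulVK z w : S1 z -> cmul z (cmul (conjc z) w) = w.
Proof.
rewrite /S1 /= => hz; case: w => a b; rewrite /cmul /=; congr pair.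
  transitivity ((z.1 ^+ 2 + z.2 ^+ 2) * a); [ring|by rewrite hz mul1r].
transitivity ((z.1 ^+ 2 + z.2 ^+ 2) * b); [ring|by rewrite hz mul1r].
Qed.

Lemma S1_gtN1 z : S1 z -> z <> oppc (1, 0) -> -1 < z.1.
Proof.
case: z => a b; rewrite /S1 /oppc /= => h nz.
have : -1 <= a by nra.
rewrite le_eqVlt => /orP[/eqP e|//]; case: nz; rewrite -e oppr0; congr pair.
by apply/eqP; rewrite -sqrf_eq0; apply/eqP; nra.
Qed.

Lemma sqrtc_spec z : S1 z -> -1 < z.1 -> S1 (sqrtc z) /\ cmul (sqrtc z) (sqrtc z) = z.
Proof.
case: z => a b; rewrite /S1 /sqrtc /cmul /= => h a1.
set d := Num.sqrt _.
have d2 : d ^+ 2 = 2 + 2 * a by rewrite sqr_sqrtr; lra.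
have d0 : d != 0 by rewrite gt_eqF // sqrtr_gt0; lra.
have a0 : 1 + a != 0 by lra.
split.
  rewrite !expr_div_n d2.
  have -> : b ^+ 2 = 1 - a ^+ 2 by lra.
  field; lra.
congr pair.
  transitivity (((1 + a) ^+ 2 - b ^+ 2) / d ^+ 2); first by field.
  rewrite d2; have -> : b ^+ 2 = 1 - a ^+ 2 by lra.
  field; lra.
transitivity (2 * (1 + a) * b / d ^+ 2); first by field.
rewrite d2; field; lra.
Qed.

(** Square roots of one unit number agree up to sign, and the inner product makes that sign a
    continuous function. *)
Lemma dot_sqr z w : S1 z -> S1 w -> cmul z z = cmul w w ->
  (dot z w = 1 /\ z = w) \/ (dot z w = -1 /\ z = oppc w).
Proof.
case: z => a b; case: w => c d; rewrite /S1 /cmul /dot /oppc /= => h1 h2 [e1 e2].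
have ac : a ^+ 2 = c ^+ 2 by nra.
have bd : b ^+ 2 = d ^+ 2 by nra.
have abcd : a * b = c * d by lra.
have D2 : (a * c + b * d) ^+ 2 = 1.
  transitivity (a ^+ 2 * c ^+ 2 + b ^+ 2 * d ^+ 2 + 2 * (a * b) * (c * d)); first ring.
  rewrite ac bd abcd; transitivity ((c ^+ 2 + d ^+ 2) ^+ 2); [ring|by rewrite h2 expr1n].
have : (a * c + b * d == 1) || (a * c + b * d == -1) by rewrite -eqf_sqr D2 expr1n.
case/orP => /eqP e; [left|right]; split=> //; congr pair; apply/eqP.
- by rewrite -subr_eq0 -sqrf_eq0; apply/eqP; nra.
- by rewrite -subr_eq0 -sqrf_eq0; apply/eqP; nra.
- by rewrite -subr_eq0 -sqrf_eq0; apply/eqP; nra.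
- by rewrite -subr_eq0 -sqrf_eq0; apply/eqP; nra.
Qed.

(** Lying in a common open half-plane is an open condition; it serves to keep nearby points from
    being antipodal. *)
Lemma dot_gt0 z w u : 0 < dot z u -> 0 < dot w u -> z <> oppc w.
Proof.
case: z w u => a b [c d] [e f]; rewrite /dot /oppc /= => h1 h2 [za zb].
by move: h1; rewrite za zb; lra.
Qed.

Lemma dot_self z : S1 z -> dot z z = 1.
Proof. by rewrite /S1 /dot /= !expr2. Qed.

Section Continuity.
Variable T : topologicalType.
Implicit Types (f g : T -> (R * R)%type) (x : T).

Lemma cont_cst (U : topologicalType) (c : U) x : {for x, continuous (fun=> c : U)}.
Proof. exact: cvg_cst. Qed.

Lemma contD (f g : T -> R) x : {for x, continuous f} -> {for x, continuous g} ->
  {for x, continuous (fun t => f t + g t)}.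
Proof. by move=> hf hg; apply: (continuousD hf hg). Qed.

Lemma contM (f g : T -> R) x : {for x, continuous f} -> {for x, continuous g} ->
  {for x, continuous (fun t => f t * g t)}.
Proof. by move=> hf hg; apply: (continuousM hf hg). Qed.

Lemma contN (f : T -> R) x : {for x, continuous f} -> {for x, continuous (fun t => - f t)}.
Proof. by move=> hf; apply: (continuousN hf). Qed.

Lemma contB (f g : T -> R) x : {for x, continuous f} -> {for x, continuous g} ->
  {for x, continuous (fun t => f t - g t)}.
Proof. by move=> hf hg; apply: (continuousB hf hg). Qed.

Lemma contV (f : T -> R) x : f x != 0 -> {for x, continuous f} ->
  {for x, continuous (fun t => (f t)^-1)}.
Proof. by move=> f0 hf; apply: (continuousV f0 hf). Qed.

Lemma cont_sqrt (f : T -> R) x : {for x, continuous f} ->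
  {for x, continuous (fun t => Num.sqrt (f t))}.
Proof. by move=> hf; apply: (continuous_comp hf); exact: sqrt_continuous. Qed.

Lemma cont_pair (f1 f2 : T -> R) x : {for x, continuous f1} -> {for x, continuous f2} ->
  {for x, continuous (fun t => (f1 t, f2 t))}.
Proof.
move=> h1 h2; exact: (@cvg_pair _ _ _ (nbhs x) (nbhs (f1 x)) (nbhs (f2 x)) _ _ _ f1 f2 h1 h2).
Qed.

Lemma cont_fst f x : {for x, continuous f} -> {for x, continuous (fun t => (f t).1)}.
Proof. by move=> h; apply: (@continuous_comp _ _ _ f fst x h); exact: cvg_fst. Qed.

Lemma cont_snd f x : {for x, continuous f} -> {for x, continuous (fun t => (f t).2)}.
Proof. by move=> h; apply: (@continuous_comp _ _ _ f snd x h); exact: cvg_snd. Qed.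

Lemma cont_cmul f g x : {for x, continuous f} -> {for x, continuous g} ->
  {for x, continuous (fun t => cmul (f t) (g t))}.
Proof.
move=> hf hg; have f1 := cont_fst hf; have f2 := cont_snd hf.
have g1 := cont_fst hg; have g2 := cont_snd hg.
exact: (cont_pair (contB (contM f1 g1) (contM f2 g2)) (contD (contM f1 g2) (contM f2 g1))).
Qed.

Lemma cont_conj f x : {for x, continuous f} -> {for x, continuous (fun t => conjc (f t))}.
Proof. by move=> hf; exact: (cont_pair (cont_fst hf) (contN (cont_snd hf))). Qed.

Lemma cont_dot f g x : {for x, continuous f} -> {for x, continuous g} ->
  {for x, continuous (fun t => dot (f t) (g t))}.
Proof.
move=> hf hg; have f1 := cont_fst hf; have f2 := cont_snd hf.
have g1 := cont_fst hg; have g2 := cont_snd hg.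
exact: (contD (contM f1 g1) (contM f2 g2)).
Qed.

Lemma cont_sqrtc f x : {for x, continuous f} -> -1 < (f x).1 ->
  {for x, continuous (fun t => sqrtc (f t))}.
Proof.
move=> hf h; have f1 := cont_fst hf; have f2 := cont_snd hf.
have dc := cont_sqrt (contD (@cont_cst R 2 x) (contM (@cont_cst R 2 x) f1)).
have d0 : Num.sqrt (2 + 2 * (f x).1) != 0 by rewrite gt_eqF // sqrtr_gt0; lra.
have dv := contV d0 dc.
exact: (cont_pair (contM (contD (@cont_cst R 1 x) f1) dv) (contM f2 dv)).
Qed.

End Continuity.

End Plane.

(** * Square roots along paths in the circle *)

Section RootLift.
Variable R : realType.
Implicit Types g h : R -> (R * R)%type.

Lemma continuous_forall (T U : topologicalType) (f : T -> U) :
  (forall t, {for t, continuous f}) -> continuous f.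
Proof. by []. Qed.

Lemma cont_near_eq (T U : topologicalType) (f g : T -> U) x :
  (\forall y \near x, f y = g y) -> {for x, continuous g} -> {for x, continuous f}.
Proof.
move=> fg cg; have fx : f x = g x := nbhs_singleton fg.
change (f @ x --> f x); rewrite fx; apply: cvg_trans cg.
by apply: near_eq_cvg; near do apply: esym.
Unshelve. all: by end_near. Qed.

Lemma pm1_const (f : R -> R) (a b : R) : a <= b ->
  (forall t, a <= t <= b -> {for t, continuous f} /\ (f t = 1 \/ f t = -1)) ->
  f a = f b.
Proof.
move=> ab hf.
have ct : {within `[a, b], continuous f}.
  apply: continuous_in_subspaceT => t; rewrite inE /= in_itv /= => tab.
  exact: (hf t tab).1.
apply: contrapT => ne.
have : Num.min (f a) (f b) <= 0 <= Num.max (f a) (f b).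
  have [_ ha] := hf a ltac:(by rewrite lexx ab); have [_ hb] := hf b ltac:(by rewrite lexx ab).
  rewrite ge_min le_max.
  move: ne; case: ha => ->; case: hb => -> ne; try (by case: ne); rewrite ?ler01 ?lerN10 ?orbT //=.
move=> /(IVT ab ct)[c]; rewrite in_itv /= => cab fc.
have [_] := hf c cab; rewrite fc => -[/eqP|/eqP]; first by rewrite eq_sym oner_eq0.
by rewrite eq_sym oppr_eq0 oner_eq0.
Qed.

Definition root_lift g h := continuous h /\ forall t, S1 (h t) /\ cmul (h t) (h t) = g t.

Lemma root_lift_S1 g h t : root_lift g h -> S1 (g t).
Proof. by move=> [_ /(_ t)[h1 <-]]; exact: S1_cmul. Qed.

Lemma cmul_conj_gtN1 (z w : R * R) : S1 z -> S1 w -> w <> oppc z -> -1 < (cmul w (conjc z)).1.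
Proof.
move=> hz hw ne; apply: S1_gtN1; first exact/S1_cmul/S1_conj.
rewrite cmulC => e; apply: ne; rewrite -(cmulVK w hz) e /cmul /oppc /=.
by congr pair; ring.
Qed.

(** The quotient g' / g avoids -1, so its principal square root is continuous and carries a root of
    [g] to one of [g']. This takes the place of covering space theory. *)
Lemma root_lift_near g g' h : root_lift g h -> continuous g -> continuous g' ->
  (forall t, S1 (g' t)) -> (forall t, g' t <> oppc (g t)) ->
  root_lift g' (fun t => cmul (h t) (sqrtc (cmul (g' t) (conjc (g t))))).
Proof.
move=> lh cg cg' Sg' ne; have [ch hh] := lh.
have Sg t := root_lift_S1 t lh.
have gt t : -1 < (cmul (g' t) (conjc (g t))).1 by exact: cmul_conj_gtN1.
split=> [|t].
  apply: continuous_forall => t; apply: cont_cmul; first exact: ch.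
  by apply: cont_sqrtc => //; apply: cont_cmul; [exact: cg'|apply: cont_conj; exact: cg].
have [Sh hE] := hh t.
have [Ss sE] := sqrtc_spec (S1_cmul (Sg' t) (S1_conj (Sg t))) (gt t).
split; first exact: S1_cmul.
rewrite cmulA -(cmulA (h t)) (cmulC _ (h t)) cmulA -cmulA sE hE.
by rewrite [cmul (g' t) _]cmulC cmulVK.
Qed.

(** Two lifts differ by a global sign, which cancels in the quotient. *)
Lemma root_lift_uniq g h1 h2 : root_lift g h1 -> root_lift g h2 ->
  cmul (h1 1) (conjc (h1 0)) = cmul (h2 1) (conjc (h2 0)).
Proof.
move=> [c1 l1] [c2 l2].
have D t := dot_sqr (l1 t).1 (l2 t).1 (etrans (l1 t).2 (esym (l2 t).2)).
have : dot (h1 0) (h2 0) = dot (h1 1) (h2 1).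
  apply: (@pm1_const (fun t => dot (h1 t) (h2 t))) => // t _; split.
    by apply: cont_dot; [exact: c1|exact: c2].
  by case: (D t) => -[-> _]; [left|right].
case: (D 0) => -[-> ->]; case: (D 1) => -[-> ->] // e; try by exfalso; lra.
by rewrite /cmul /oppc /=; congr pair; ring.
Qed.

(** The retraction of the line onto [0, 1], in a closed form whose continuity is immediate; it turns
    paths on [II] into functions on the line. *)
Definition clamp (t : R) : R := (`|t| - `|t - 1| + 1) / 2.

Lemma clamp_itv t : 0 <= clamp t <= 1.
Proof.
rewrite /clamp.
by case: (ger0P t) => ?; case: (ger0P (t - 1)) => ?; lra.
Qed.

Lemma clamp_id t : 0 <= t <= 1 -> clamp t = t.
Proof.
rewrite /clamp => ?.
by case: (ger0P t) => ?; case: (ger0P (t - 1)) => ?; lra.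
Qed.

Lemma clamp_cont : continuous clamp.
Proof.
apply: continuous_forall => t; apply: contM; last exact: cont_cst.
apply: contD; last exact: cont_cst.
apply: contB; first exact: norm_continuous.
apply: (@continuous_comp _ _ _ (fun t : R => t - 1) (fun x : R => `|x|)); last exact: norm_continuous.
by apply: contB; [exact: cvg_id|exact: cont_cst].
Qed.

Lemma unit_root (z : R * R) : S1 z -> exists2 w, S1 w & cmul w w = z.
Proof.
move=> hz; have [e|ne] := pselect (z = oppc (1, 0)).
  exists (0, 1); first by rewrite /S1 /= expr0n /= add0r expr1n.
  by rewrite e /cmul /oppc /=; congr pair; ring.
by have [] := sqrtc_spec hz (S1_gtN1 hz ne); exists (sqrtc z).
Qed.

Lemma unit_path_unif g : continuous g -> (forall t, S1 (g t)) ->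
  exists N : nat, forall x y, 0 <= x <= 1 -> `|y - x| <= N.+1%:R^-1 -> g y <> oppc (g x).
Proof.
move=> cg Sg; have /compact_near_coveringP/near_covering_withinP := @segment_compact R 0 1.
move=> /(_ nat \oo (fun N x => forall y, `|y - x| <= N.+1%:R^-1 -> g y <> oppc (g x)) _).
case.
  move=> x0 x01.
  have : \forall y \near x0, 0 < dot (g y) (g x0).
    have c0 : {for x0, continuous (fun y => dot (g y) (g x0))}.
      by apply: cont_dot; [exact: cg|exact: cont_cst].
    by apply: (cvgr_gt _ c0); rewrite dot_self.
  move=> /nbhs_ballP[e /= e0 he].
  exists (ball x0 (e / 2), [set N | N.+1%:R^-1 < e / 2]).
    split; first by apply: nbhsx_ballx; lra.
    have e2 : 0 < e / 2 by lra.
    exact: (near_infty_natSinv_lt (PosNum e2)).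
  move=> [x N] /= [xx0 Ne] x1 y yx; apply: (@dot_gt0 _ _ _ (g x0)).
    apply: he; rewrite /ball /= distrC; move: xx0; rewrite /ball /= => xx0.
    have := ler_normD (y - x) (x - x0); rewrite addrA subrK => tri.
    rewrite distrC in xx0; apply: (le_lt_trans tri).
    by rewrite (splitr e) ltrD // (le_lt_trans yx).
  apply: he; apply: le_ball xx0; lra.
move=> N _ hN; exists N => x y x01 yx; by apply: (hN N) => //=.
Qed.

Lemma root_lift_exists g : continuous g -> (forall t, S1 (g t)) ->
  exists h, root_lift (fun t => g (clamp t)) h.
Proof.
move=> cg Sg; have [N hN] := unit_path_unif cg Sg.
(* The path is grown from its starting point: [gk 0] is constant, [gk N.+1] is the whole path, and
   consecutive stages are too close to be antipodal. *)
pose gk (k : nat) t := g (k%:R / N.+1%:R * clamp t).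
have cgk k : continuous (gk k).
  apply: continuous_forall => t; apply: (@continuous_comp _ _ _ (fun t => k%:R / N.+1%:R * clamp t) g); last exact: cg.
  by apply: contM; [exact: cont_cst|exact: clamp_cont].
suff: forall k, (k <= N.+1)%N -> exists h, root_lift (gk k) h.
  move=> /(_ N.+1 (leqnn _))[h hh]; exists h.
  by have -> : (fun t => g (clamp t)) = gk N.+1 by apply/funext => t; rewrite /gk divff ?mul1r.
elim=> [_|k IH kN].
  have [w Sw ww] := unit_root (Sg 0).
  exists (fun=> w); split; first by move=> t; exact: cont_cst.
  by move=> t; rewrite /gk mul0r mul0r.
have [h lh] := IH (ltnW kN).
exists (fun t => cmul (h t) (sqrtc (cmul (gk k.+1 t) (conjc (gk k t))))).
apply: root_lift_near => // t; first exact: Sg.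
have /andP[c0 c1] := clamp_itv t.
have N0 : 0 < N.+1%:R^-1 :> R by rewrite invr_gt0 ltr0n.
have kN1 : k%:R * N.+1%:R^-1 <= 1 :> R by rewrite ler_pdivrMr ?ltr0n // mul1r ler_nat ltnW.
have k0 : 0 <= k%:R * N.+1%:R^-1 :> R by rewrite mulr_ge0 // ltW.
apply: hN; first by apply/andP; split; [exact: mulr_ge0|exact: mulr_ile1].
have -> : k.+1%:R / N.+1%:R * clamp t - k%:R / N.+1%:R * clamp t = N.+1%:R^-1 * clamp t :> R.
  by rewrite -mulrBl -mulrBl -natrB // subSnn mul1r.
rewrite ger0_norm; first by apply: ler_piMr => //; exact: ltW.
by apply: mulr_ge0 => //; exact: ltW.
Qed.

(** The square root of g(1) / g(0) obtained by continuation along [g]; the default is taken when [g]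
    has no continuous root. *)
Definition rootq g : R * R :=
  xget (1, 0) [set q | exists2 h, root_lift g h & q = cmul (h 1) (conjc (h 0))].

Lemma rootqE g h : root_lift g h -> rootq g = cmul (h 1) (conjc (h 0)).
Proof.
move=> lh; rewrite /rootq; case: xgetP => [q _ [h' lh' ->]|]; last first.
  by move=> /(_ (cmul (h 1) (conjc (h 0)))) []; exists h.
exact: root_lift_uniq lh' lh.
Qed.

Lemma rootq_spec g : (exists h, root_lift g h) ->
  S1 (rootq g) /\ cmul (rootq g) (rootq g) = cmul (g 1) (conjc (g 0)).
Proof.
move=> [h lh]; rewrite (rootqE lh); have [_ hh] := lh.
have [S10 <-] := hh 0; have [S11 <-] := hh 1.
split; first exact/S1_cmul/S1_conj.
by rewrite /cmul /=; congr pair; ring.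
Qed.

(** Near [x] a root of [F y] is the root of [F x] times a principal root, so the value depends on
    [y] only through the endpoints of [F y]. *)
Lemma rootq_cont (T : topologicalType) (F : T -> R -> (R * R)%type) x :
  (\forall y \near x, continuous (F y) /\ forall t, S1 (F y t) /\ F y t <> oppc (F x t)) ->
  (exists h, root_lift (F x) h) ->
  {for x, continuous (fun y => F y 0)} -> {for x, continuous (fun y => F y 1)} ->
  {for x, continuous (fun y => rootq (F y))}.
Proof.
move=> nF [h lh] c0 c1.
pose r y t := sqrtc (cmul (F y t) (conjc (F x t))).
apply: (@cont_near_eq _ _ _ (fun y => cmul (cmul (h 1) (r y 1)) (conjc (cmul (h 0) (r y 0))))).
  have [cFx _] := nbhs_singleton nF.
  near=> y; have [cFy hF] : continuous (F y) /\ forall t, S1 (F y t) /\ F y t <> oppc (F x t).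
    by near: y.
  apply: (@rootqE _ (fun t => cmul (h t) (r y t))).
  by apply: root_lift_near => // t; have [] := hF t.
have one t : -1 < (cmul (F x t) (conjc (F x t))).1.
  have := root_lift_S1 t lh; rewrite /S1 /cmul /= => S.
  by have -> : (F x t).1 * (F x t).1 - (F x t).2 * - (F x t).2 = 1 by rewrite -S; ring.
have cr t : {for x, continuous (fun y => F y t)} -> {for x, continuous (fun y => r y t)}.
  move=> ct; apply: cont_sqrtc => //; apply: cont_cmul => //.
  exact: cont_cst.
apply: cont_cmul; first by apply: cont_cmul; [exact: cont_cst|exact: cr].
by apply: cont_conj; apply: cont_cmul; [exact: cont_cst|exact: cr].
Unshelve. all: by end_near. Qed.

End RootLift.

(** * The circle, the torus and their path spaces *)

Section Circle.
Variable R : realType.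

(** This is e^(i pi t): a unit step is the antipode, so the glide becomes s -> s + 1, and [circ a]
    is a square root of [circ (2 * a)]. *)
Definition circ (t : R) : R * R := (cos (pi * t), sin (pi * t)).

Lemma S1_circ t : S1 (circ t).
Proof. exact: cos2Dsin2. Qed.

Lemma circD a b : circ (a + b) = cmul (circ a) (circ b).
Proof. by rewrite /circ /cmul /= mulrDr cosD sinD; congr pair; ring. Qed.

Lemma circN a : circ (- a) = conjc (circ a).
Proof. by rewrite /circ /conjc mulrN cosN sinN. Qed.

Lemma circD1 a : circ (a + 1) = oppc (circ a).
Proof. by rewrite /circ /oppc /= mulrDr mulr1 cosDpi sinDpi. Qed.

Lemma circ0 : circ 0 = (1, 0).
Proof. by rewrite /circ mulr0 cos0 sin0. Qed.

Lemma circ1 : circ 1 = (-1, 0).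
Proof. by have := circD1 0; rewrite add0r circ0 => ->; rewrite /oppc /= oppr0. Qed.

Lemma circ2 a : cmul (circ a) (circ a) = circ (2 * a).
Proof. by rewrite -circD; congr circ; ring. Qed.

Lemma circ_cont : continuous circ.
Proof.
apply: continuous_forall => t.
have c : {for t, continuous (fun t : R => pi * t)} by apply: contM; [exact: cont_cst|exact: cvg_id].
apply: cont_pair.
  by apply: (continuous_comp c); exact: continuous_cos.
by apply: (continuous_comp c); exact: continuous_sin.
Qed.

Lemma torus_val (x : torus R) : torus_set (val x).
Proof. exact: set_mem (valP x). Qed.

Lemma S1_fst (x : torus R) : S1 (val x).1.
Proof. exact: (torus_val x).1. Qed.

Lemma S1_snd (x : torus R) : S1 (val x).2.
Proof. exact: (torus_val x).2. Qed.

Definition mkT (z w : R * R) (hz : S1 z) (hw : S1 w) : torus R :=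
  exist _ (z, w) (mem_set (conj hz hw)).

Lemma torus_eq (x y : torus R) : (val x).1 = (val y).1 -> (val x).2 = (val y).2 -> x = y.
Proof.
move=> h1 h2; apply/val_inj; move: h1 h2.
by case: (val x) (val y) => [? ?] [? ?] /= -> ->.
Qed.

Section IntoTorus.
Variables (T : topologicalType) (f : T -> torus R) (x : T).

Lemma torus_cont : {for x, continuous (fun t => (val (f t)).1)} ->
  {for x, continuous (fun t => (val (f t)).2)} -> {for x, continuous f}.
Proof.
move=> h1 h2.
have h : {for x, continuous (fun t => val (f t))}.
  have -> : (fun t => val (f t)) = (fun t => ((val (f t)).1, (val (f t)).2)).
    by apply/funext => t; case: (val (f t)).
  exact: (@cvg_pair _ _ _ (nbhs x) (nbhs (val (f x)).1) (nbhs (val (f x)).2) _ _ _ _ _ h1 h2).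
move=> A [_ [[B oB <-] Bx] BA].
have : nbhs x (f @^-1` (set_val @^-1` B)) by apply: h; exact: open_nbhs_nbhs.
by apply: filterS => t; exact: BA.
Qed.

Lemma torus_cont_fst : {for x, continuous f} -> {for x, continuous (fun t => (val (f t)).1)}.
Proof.
move=> h; apply: (@continuous_comp _ _ _ (fun t => val (f t)) fst); last exact: cvg_fst.
by apply: (continuous_comp h); exact: initial_continuous.
Qed.

Lemma torus_cont_snd : {for x, continuous f} -> {for x, continuous (fun t => (val (f t)).2)}.
Proof.
move=> h; apply: (@continuous_comp _ _ _ (fun t => val (f t)) snd); last exact: cvg_snd.
by apply: (continuous_comp h); exact: initial_continuous.
Qed.

End IntoTorus.

Lemma unitI_clamp (t : R) : unitI (clamp t).
Proof. exact: clamp_itv. Qed.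

Definition toI (t : R) : II R := exist _ (clamp t) (mem_set (unitI_clamp t)).

Lemma toI_clamp t : toI (clamp t) = toI t.
Proof. by apply/val_inj => /=; rewrite clamp_id // clamp_itv. Qed.

Lemma toI0 : toI 0 = I0 R.
Proof. by apply/val_inj; rewrite /= clamp_id // lexx ler01. Qed.

Lemma toI1 : toI 1 = I1 R.
Proof. by apply/val_inj; rewrite /= clamp_id // lexx ler01. Qed.

Lemma toI_cont : continuous toI.
Proof.
move=> t A [_ [[B oB <-] Bx] BA].
have : nbhs t (toI @^-1` (set_val @^-1` B)) by apply: clamp_cont; exact: open_nbhs_nbhs.
by apply: filterS => s; exact: BA.
Qed.

Section PathSpace.
Variable X : topologicalType.

Lemma path_eval_cont (t : II R) : continuous (fun g : pathsp R X => (g : II R -> X) t).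
Proof.
move=> g A; rewrite /= nbhsE => -[B [oB Bg] BA].
have /compact_open_cvgP : (nbhs g : set_system (pathsp R X)) --> g by exact: cvg_id.
move=> /(_ [set t] B (@compact_set1 _ t) oB) h.
have : nbhs g [set h : pathsp R X | h @` [set t] `<=` B] by apply: h => _ [_ -> <-].
by apply: filterS => h' hh; apply: BA; apply: hh; exists t.
Qed.

(** Around each time [t0], a compact-open neighbourhood of [g0] keeps a closed interval of times in
    the half-plane about [phi (g0 (toI t0))]; compactness of [0, 1] makes this uniform. *)
Lemma path_tube (g0 : pathsp R X) (phi : X -> (R * R)%type) :
  continuous (g0 : II R -> X) -> continuous phi -> (forall x, S1 (phi x)) ->
  \forall g \near g0, forall t, phi (g (toI t)) <> oppc (phi (g0 (toI t))).
Proof.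
move=> c0 cphi Sphi.
suff : \forall g \near g0, `[0, 1] `<=` [set t | phi (g (toI t)) <> oppc (phi (g0 (toI t)))].
  apply: filterS => g hg t; rewrite -toI_clamp; apply: hg.
  by rewrite /= in_itv /= clamp_itv.
have cf : continuous (fun t => phi (g0 (toI t))).
  move=> t; apply: (@continuous_comp _ _ _ (fun t => g0 (toI t)) phi); last exact: cphi.
  by apply: continuous_comp; [exact: toI_cont|exact: c0].
have /compact_near_coveringP := @segment_compact R 0 1.
move=> /(_ _ (nbhs g0) (fun g t => phi (g (toI t)) <> oppc (phi (g0 (toI t)))) _); apply => t0 _.
set z0 := phi (g0 (toI t0)).
have /nbhs_ballP[e /= e0 he] : \forall t \near t0, 0 < dot (phi (g0 (toI t))) z0.
  have c : {for t0, continuous (fun t => dot (phi (g0 (toI t))) z0)}.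
    by apply: cont_dot; [exact: cf|exact: cont_cst].
  by apply: (cvgr_gt _ c); rewrite dot_self.
pose K := toI @` `[t0 - e / 2, t0 + e / 2].
pose O := [set y | 0 < dot (phi y) z0].
have oO : open O.
  rewrite openE => y Oy.
  have c : {for y, continuous (fun y => dot (phi y) z0)}.
    by apply: cont_dot; [exact: cphi|exact: cont_cst].
  exact: (cvgr_gt _ c).
have cK : compact K.
  apply: continuous_compact; last exact: segment_compact.
  by apply: continuous_subspaceT; exact: toI_cont.
have /compact_open_cvgP : (nbhs g0 : set_system (pathsp R X)) --> g0 by exact: cvg_id.
move=> /(_ K O cK oO) hKO.
have in_ball t : t0 - e / 2 <= t <= t0 + e / 2 -> ball t0 e t.
  by move=> ht; rewrite /ball /= ltr_norml; lra.
have nK : nbhs g0 [set h : pathsp R X | h @` K `<=` O].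
  apply: hKO => _ [_ [t + <-] <-]; rewrite /= in_itv /= => ht.
  by apply: he; exact: in_ball.
exists (ball t0 (e / 2), [set h : pathsp R X | h @` K `<=` O]).
  by split=> //; apply: nbhsx_ballx; lra.
move=> [t g] /= [tb gK]; apply: (@dot_gt0 _ _ _ z0).
  apply: gK; exists (toI t) => //; exists t => //=; rewrite in_itv /=.
  by move: tb; rewrite /ball /= ltr_norml => ?; lra.
by apply: he; apply: le_ball tb; lra.
Qed.

End PathSpace.
End Circle.

Section Orbits.
Variable R : realType.
Let sK := @sigma_antK R.

Lemma proj_eq (x y : torus R) : Defs.proj sK x = Defs.proj sK y -> y = x \/ y = sigma_ant x.
Proof.
move=> e; have /(eqmodP (orb_equiv sK)) : x = y %[mod {eq_quot (orb_equiv sK)}] by exact: e.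
by rewrite /= /orb_rel => /orP[/eqP|/eqP]; [left|right].
Qed.

Lemma proj_sigma (x : torus R) : Defs.proj sK (sigma_ant x) = Defs.proj sK x.
Proof.
have : sigma_ant x = x %[mod {eq_quot (orb_equiv sK)}].
  by apply/eqmodP; rewrite /= /orb_rel sK eqxx orbT.
by [].
Qed.

Lemma proj_cont : continuous (Defs.proj sK).
Proof. exact: pi_continuous. Qed.

Lemma ptws_cont (J : Type) (T Y : topologicalType) (f : T -> {ptws J -> Y}) x :
  (forall j, {for x, continuous (fun t => f t j)}) -> {for x, continuous f}.
Proof.
move=> h; apply/cvg_sup => j A [_ [[B oB <-] Bx] BA].
have : nbhs x ((fun t => f t j) @^-1` B) by apply: h; exact: open_nbhs_nbhs.
by apply: filterS => t; exact: BA.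
Qed.
End Orbits.

(** * Lower bound *)

Section Parametrization.
Variables (R : realType) (n : nat).
Let sK := @sigma_antK R.
Let J : finType := 'I_n.-1.
Let I := cell_idx J.

Definition coord (v : 'rV[R]_#|{: I}|) (i : I) : R := v ord0 (enum_rank i).

Definition tp (a b : R) : torus R := mkT (S1_circ a) (S1_circ b).

(* The slice x' = 1 of the base, parametrized by its universal cover. *)
Definition par (v : 'rV[R]_#|{: I}|) : Mbase sK n :=
  (tp 0 (2 * coord v (cr J)),
   fun j => Defs.proj sK (tp (coord v (cs j)) (2 * coord v (ct j)))).

Lemma coord_cont i : continuous (fun v => coord v i).
Proof. by move=> v; exact: coord_continuous. Qed.

Lemma tp_cont (T : topologicalType) (a b : T -> R) x :
  {for x, continuous a} -> {for x, continuous b} ->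
  {for x, continuous (fun t => tp (a t) (b t))}.
Proof.
by move=> ha hb; apply: torus_cont; [apply: (continuous_comp ha)|apply: (continuous_comp hb)];
  exact: circ_cont.
Qed.

Lemma par_cont : continuous par.
Proof.
move=> v; have c i : {for v, continuous (fun v => coord v i)} by exact: coord_cont.
have c2 i : {for v, continuous (fun v => 2 * coord v i)}.
  by apply: contM => //; exact: cont_cst.
have h1 : {for v, continuous (fun v => tp 0 (2 * coord v (cr J)))}.
  by apply: tp_cont => //; exact: cont_cst.
have h2 : {for v, continuous (fun v => (fun j => Defs.proj sK (tp (coord v (cs j)) (2 * coord v (ct j)))) : {ptws J -> orbsp sK})}.
  apply: ptws_cont => j.
  apply: (@continuous_comp _ _ _ (fun v => tp (coord v (cs j)) (2 * coord v (ct j)))).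
    exact: tp_cont.
  exact: proj_cont.
exact: (@cvg_pair _ _ _ (nbhs v) (nbhs (par v).1) (nbhs (par v).2) _ _ _ _ _ h1 h2).
Qed.

Definition vec (M : nat) (p : I -> int) : 'rV[R]_#|{: I}| :=
  \row_i ((p (enum_val i))%:~R / M%:R).

Lemma coord_vec M p i : coord (vec M p) i = (p i)%:~R / M%:R.
Proof. by rewrite /coord mxE enum_rankK. Qed.

Lemma coord_deck M p i k : (0 < M)%N ->
  coord (vec M (deck M (@klein_refl J) i p)) k =
  (if klein_refl i == Some k then - coord (vec M p) k else coord (vec M p) k) +
  (if k == i then 1 else 0).
Proof.
move=> M0; have MR : M%:R != 0 :> R by rewrite pnatr_eq0 -lt0n.
rewrite !coord_vec /deck rmorphD /= mulrDl; congr (_ + _).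
  by case: ifP => _ //; rewrite rmorphN mulNr.
by case: ifP => _; rewrite ?mul0r // divff.
Qed.

Lemma circ_double1 (a : R) : circ (2 * (a + 1)) = circ (2 * a).
Proof.
have -> : 2 * (a + 1) = 2 * a + 1 + 1 by ring.
by rewrite !circD1 /oppc /= !opprK.
Qed.

Lemma par_deck M p i : (0 < M)%N -> par (vec M (deck M (@klein_refl J) i p)) = par (vec M p).
Proof.
move=> M0; case: i => [[k b]|]; rewrite /par; congr pair.
- by apply: torus_eq => //=; rewrite coord_deck //= addr0; case: b.
- apply/funext => j; rewrite !coord_deck //; case: b.
    rewrite -/(ct k) (negbTE (cs_ct _ _)) /= addr0.
    case: ifP => _; rewrite ?addr0 //.
    by congr Defs.proj; apply: torus_eq => //=; rewrite circ_double1.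
  rewrite -/(cs k) (negbTE (ct_cs _ _)) !addr0 /=.
  have -> : (Some (ct k) == Some (cs j)) = false by exact: (negbTE (ct_cs _ _)).
  have -> : (Some (ct k) == Some (ct j)) = (j == k).
    by rewrite eq_sym; apply/eqP/eqP => [[]|->].
  have -> : (cs j == cs k) = (j == k) by apply/eqP/eqP => [[]|->].
  case: ifP => _; last by rewrite addr0.
  rewrite -[RHS]proj_sigma; congr Defs.proj; apply: torus_eq => /=.
    by rewrite circD1.
  by rewrite mulrN circN.
- by apply: torus_eq => //=; rewrite coord_deck //= circ_double1.
- by apply/funext => j; rewrite !coord_deck //= !addr0.
Qed.

(** * The sign attached to a local section *)

Section LocalSection.
Variables (s : Mbase sK n -> Mamb R (torus R) n) (W : set (Mbase sK n)).
Hypotheses (oW : open W) (cont_s : {within W, continuous s}).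
Hypothesis sW : forall b, W b -> @Mn R (torus R) n (s b) /\ effl_map sK (s b) = b.

Definition start_arc b (t : R) : R * R := (val ((s b).1 (toI t))).2.
Definition end_arc j b (t : R) : R * R := (val ((s b).2 j (toI t))).2.
Definition lift_pt j b : torus R := (s b).2 j (I1 R).
(** The root of y''_j / x'' obtained by returning along the first path to the common start and
    leaving along the j-th one. *)
Definition half_angle j b : R * R := cmul (rootq (end_arc j b)) (conjc (rootq (start_arc b))).
(** Over [W] this is a sign: it tells whether the j-th path ends at the point with coordinates (s,
    2t) or at its image under [sigma_ant]. *)
Definition orient j v : R := dot (val (lift_pt j (par v))).1 (circ (coord v (cs j))).
Definition half_pt j v : R * R :=
  (cos (pi * coord v (ct j)), orient j v * sin (pi * coord v (ct j))).
(** Since [circ r] is a root of x'', over [W] both arguments of [dot] are roots of y''_j at the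
    lifted point, so the value is 1 or -1. *)
Definition monodromy j v : R :=
  dot (cmul (circ (coord v (cr J))) (half_angle j (par v))) (half_pt j v).

Lemma s_cont b : W b -> {for b, continuous s}.
Proof.
by move=> Wb; move: cont_s; rewrite continuous_open_subspace // => /(_ b); apply; rewrite inE.
Qed.

Lemma start_path_cont b : W b -> {for b, continuous (fun b => (s b).1)}.
Proof.
move=> Wb; apply: (@continuous_comp _ _ _ s fst); first exact: s_cont.
exact: cvg_fst.
Qed.

Lemma end_path_cont j b : W b -> {for b, continuous (fun b => (s b).2 j)}.
Proof.
move=> Wb; apply: (@continuous_comp _ _ _ (fun b => (s b).2) (fun f => f j)).
  apply: (@continuous_comp _ _ _ s snd); first exact: s_cont.
  exact: cvg_snd.
exact: (@proj_continuous J (fun=> pathsp R (torus R)) j).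
Qed.

Lemma path_angle_cont (g : pathsp R (torus R)) : continuous (g : II R -> torus R) ->
  continuous (fun t => (val (g (toI t))).2).
Proof.
move=> cg; apply: continuous_forall => t; apply: torus_cont_snd.
by apply: continuous_comp; [exact: toI_cont|exact: cg].
Qed.

Lemma arc_lift (g : pathsp R (torus R)) : continuous (g : II R -> torus R) ->
  exists h, root_lift (fun t => (val (g (toI t))).2) h.
Proof.
move=> cg; have := root_lift_exists (path_angle_cont cg) (fun t => S1_snd _).
by under [X in root_lift X]eq_fun => t do rewrite toI_clamp.
Qed.

Lemma arc_root_cont (G : Mbase sK n -> pathsp R (torus R)) b : W b ->
  (forall b, W b -> continuous (G b : II R -> torus R)) ->
  {for b, continuous G} ->
  {for b, continuous (fun b => rootq (fun t => (val (G b (toI t))).2))}.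
Proof.
move=> Wb cG contG.
have nW : nbhs b W by exact: open_nbhs_nbhs.
have phi_c : continuous (fun x : torus R => (val x).2).
  apply: continuous_forall => x; apply: torus_cont_snd; exact: cvg_id.
have tube := contG _ (path_tube (cG b Wb) phi_c (@S1_snd R)).
have ev t : {for b, continuous (fun b => (val (G b (toI t))).2)}.
  apply: (@torus_cont_snd _ _ (fun b => G b (toI t))).
  apply: (@continuous_comp _ _ _ G (fun g : pathsp R (torus R) => g (toI t)) b contG).
  exact: path_eval_cont.
apply: rootq_cont => //; last exact: arc_lift (cG b Wb).
near=> b'; split.
  by apply/path_angle_cont/cG; near: b'.
move=> t; split; first exact: S1_snd.
by move: t; near: b'.
Unshelve. all: by end_near. Qed.

Lemma half_angle_cont j b : W b -> {for b, continuous (half_angle j)}.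
Proof.
move=> Wb; apply: cont_cmul.
  apply: (@arc_root_cont (fun b => (s b).2 j)) => // [b' Wb'|]; last exact: end_path_cont.
  by have [[_ [h _]] _] := sW Wb'; exact: h.
apply: cont_conj; apply: (@arc_root_cont (fun b => (s b).1)) => // [b' Wb'|]; last exact: start_path_cont.
by have [[h _] _] := sW Wb'.
Qed.

Lemma half_angle_spec j b : W b -> S1 (half_angle j b) /\
  cmul (half_angle j b) (half_angle j b) = cmul (val (lift_pt j b)).2 (conjc (val b.1).2).
Proof.
move=> Wb; have [[c0 [cj st]] e] := sW Wb.
have [Se sqe] := rootq_spec (arc_lift (cj j)).
have [Ss sqs] := rootq_spec (arc_lift c0).
split; first exact/S1_cmul/S1_conj.
have -> : cmul (half_angle j b) (half_angle j b) =
    cmul (cmul (rootq (end_arc j b)) (rootq (end_arc j b)))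
         (conjc (cmul (rootq (start_arc b)) (rootq (start_arc b)))).
  by rewrite /half_angle /cmul /conjc /=; congr pair; ring.
rewrite [cmul (rootq (end_arc j b)) _]sqe [cmul (rootq (start_arc b)) _]sqs toI0 toI1 st.
have -> : (s b).1 (I1 R) = b.1 by rewrite -[in RHS]e.
rewrite -/(lift_pt j b); have := S1_snd ((s b).1 (I0 R)).
move: (val (lift_pt j b)).2 (val b.1).2 (val ((s b).1 (I0 R))).2 => [y1 y2] [x1 x2] [a1 a2].
rewrite /S1 /cmul /conjc /= => h; congr pair.
  transitivity ((y1 * x1 + y2 * x2) * (a1 ^+ 2 + a2 ^+ 2)); first ring.
  by rewrite h; ring.
transitivity ((- y1 * x2 + y2 * x1) * (a1 ^+ 2 + a2 ^+ 2)); first ring.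
by rewrite h; ring.
Qed.

Lemma half_pt_spec j v : W (par v) ->
  (orient j v = 1 \/ orient j v = -1) /\
  S1 (half_pt j v) /\ cmul (half_pt j v) (half_pt j v) = (val (lift_pt j (par v))).2.
Proof.
move=> Wv; have [_ e] := sW Wv.
have /proj_eq : Defs.proj sK (tp (coord v (cs j)) (2 * coord v (ct j))) =
    Defs.proj sK (lift_pt j (par v)).
  by rewrite -[LHS]/((par v).2 j) -[in LHS]e.
case=> lE; rewrite /half_pt.
  have -> : orient j v = 1 by rewrite /orient lE dot_self //; exact: S1_circ.
  rewrite mul1r -/(circ (coord v (ct j))) lE /= circ2.
  by split; [left|split=> //; exact: S1_circ].
have -> : orient j v = -1.
  rewrite /orient lE /= /dot /=.
  have := S1_circ (coord v (cs j)); rewrite /S1 /circ /= => h.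
  by rewrite -[in RHS]h; ring.
rewrite mulN1r -[(_, _)]/(conjc (circ (coord v (ct j)))) -circN lE /= circ2 mulrN circN.
split; [by right|split; [by apply: S1_conj; exact: S1_circ|exact: circN]].
Qed.

Lemma monodromy_pm1 j v : W (par v) -> monodromy j v = 1 \/ monodromy j v = -1.
Proof.
move=> Wv; have [_ [Sh hh]] := half_pt_spec j Wv; have [Sq qq] := half_angle_spec j Wv.
set z := cmul (circ (coord v (cr J))) (half_angle j (par v)).
have Sz : S1 z by apply: S1_cmul => //; exact: S1_circ.
suff zz : cmul z z = cmul (half_pt j v) (half_pt j v).
  by case: (dot_sqr Sz Sh zz) => -[h _]; [left|right].
rewrite hh /z.
have -> (a q : R * R) : cmul (cmul a q) (cmul a q) = cmul (cmul a a) (cmul q q).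
  by rewrite /cmul /=; congr pair; ring.
rewrite circ2 qq /= [cmul (val _).2 _]cmulC cmulVK //; exact: S1_circ.
Qed.

Lemma monodromy_cont j v : W (par v) -> {for v, continuous (monodromy j)}.
Proof.
move=> Wv; have c i : {for v, continuous (fun v => coord v i)} by exact: coord_cont.
have cc i : {for v, continuous (fun v => circ (coord v i))}.
  by apply: (continuous_comp (c i)); exact: circ_cont.
have cp : {for v, continuous par} by exact: par_cont.
have cl : {for v, continuous (fun v => (val (lift_pt j (par v))).1)}.
  apply: (@torus_cont_fst _ _ (fun v => lift_pt j (par v))).
  apply: (@continuous_comp _ _ _ par (lift_pt j) v cp).
  apply: (@continuous_comp _ _ _ (fun b => (s b).2 j) (fun g : pathsp R (torus R) => g (I1 R))).
    exact: end_path_cont.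
  exact: path_eval_cont.
have co : {for v, continuous (orient j)} := cont_dot cl (cc (cs j)).
apply: cont_dot.
  apply: cont_cmul => //; apply: (continuous_comp cp); exact: half_angle_cont.
by apply: cont_pair; [exact: cont_fst (cc (ct j))|apply: contM => //; exact: cont_snd (cc (ct j))].
Qed.

Definition monodromy_bit j v : bool := monodromy j v < 0.

Lemma monodromy_opp j v w : W (par v) -> monodromy j w = - monodromy j v ->
  monodromy_bit j w = monodromy_bit j v + 1.
Proof.
move=> Wv e; rewrite /monodromy_bit e oppr_lt0 addb1.
case: (monodromy_pm1 j Wv) => ->; rewrite ?ltr01 ?ltrN10; last by rewrite ltNge lerN10.
by rewrite ltNge ler01.
Qed.

(** A unit step in r or t_j negates one of the two roots compared. The glide in s_j fixes the lifted
    point, so it flips [orient], and it flips the sine of t_j too; the two signs cancel. The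
    character is thus that of [std_cochain j]. *)
Lemma monodromy_bit_deck M j i p : (0 < M)%N -> W (par (vec M p)) ->
  monodromy_bit j (vec M (deck M (@klein_refl J) i p)) =
  monodromy_bit j (vec M p) + ((i == cr J) || (i == ct j)).
Proof.
move=> M0 Wp; have parE := par_deck p i M0.
have same : monodromy j (vec M (deck M (@klein_refl J) i p)) = monodromy j (vec M p) ->
    monodromy_bit j (vec M (deck M (@klein_refl J) i p)) = monodromy_bit j (vec M p) + false.
  by rewrite /monodromy_bit => ->; rewrite addr0.
case: i same parE => [[k b]|] same parE; last first.
  rewrite eqxx; apply: monodromy_opp => //.
  rewrite /monodromy /half_pt /orient parE !coord_deck //= !addr0 circD1.
  by rewrite /cmul /oppc /dot /=; ring.
case: b same parE => same parE.
  rewrite -/(ct k) in same parE *.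
  have -> : ((ct k == cr J) || (ct k == ct j)) = (j == k).
    by rewrite /= eq_sym; apply/eqP/eqP => [[]|->].
  have [jk|jk] := eqVneq j k.
    rewrite -jk in same parE *; apply: monodromy_opp => //.
    rewrite /monodromy /half_pt /orient parE !coord_deck //= eqxx (negbTE (cs_ct _ _)) !addr0.
    by rewrite mulrDr mulr1 cosDpi sinDpi /dot /=; ring.
  apply: same; rewrite /monodromy /half_pt /orient parE !coord_deck //=.
  have -> : (ct j == ct k) = false by apply/negbTE; apply: contra jk => /eqP[->].
  by rewrite (negbTE (cs_ct _ _)) !addr0.
rewrite -/(cs k) in same parE *.
rewrite (negbTE (cs_ct _ _)) orbF; apply: same.
rewrite /monodromy /half_pt /orient parE !coord_deck //= (negbTE (ct_cs _ _)) !addr0.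
have -> : (Some (ct k) == Some (cs j)) = false by exact: (negbTE (ct_cs _ _)).
have -> : (Some (ct k) == Some (ct j)) = (j == k).
  by rewrite eq_sym; apply/eqP/eqP => [[]|->].
have -> : (cs j == cs k) = (j == k) by apply/eqP/eqP => [[]|->].
case: ifP => _; last by rewrite !addr0.
rewrite circD1 mulrN cosN sinN; rewrite /oppc /dot /=; ring.
Qed.

Lemma monodromy_bit_segment j (v w : 'rV[R]_#|{: I}|) :
  (forall t : R, 0 <= t <= 1 -> W (par (v + t *: (w - v)))) ->
  monodromy_bit j v = monodromy_bit j w.
Proof.
move=> hW; have := @pm1_const R (fun t => monodromy j (v + t *: (w - v))) 0 1 ler01.
have vw : v + (w - v) = w by rewrite addrC subrK.
rewrite /monodromy_bit scale0r addr0 scale1r vw => -> // t t01; split.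
  apply: (@continuous_comp _ _ _ (fun t : R => v + t *: (w - v)) (monodromy j)).
    apply: cvgD; first exact: cvg_cst.
    exact: scalel_continuous.
  by apply: monodromy_cont; exact: hW.
by apply: monodromy_pm1; exact: hW.
Qed.

End LocalSection.
End Parametrization.

Section LowerBound.
Variables (R : realType) (n : nat).
Let sK := @sigma_antK R.
Let J : finType := 'I_n.-1.
Let I := cell_idx J.

(** A Lebesgue number on the unit cube; [c] will be a number of grid steps and [N] will fix the
    mesh. *)
Lemma lebesgue_par (k : nat) (U : 'I_k -> set (Mbase sK n)) (c : R) :
  (forall i, open (U i)) -> \bigcup_(i in setT) U i = setT -> 0 < c ->
  exists N : nat, forall v : 'rV[R]_#|{: I}|, (forall i, 0 <= v ord0 i <= 1) ->
    exists l, forall w : 'rV[R]_#|{: I}|,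
      (forall i, `|v ord0 i - w ord0 i| <= c / N.+1%:R) -> U l (par w).
Proof.
move=> oU cU c0.
have := @rV_compact R #|{: I}| (fun=> `[0, 1]%classic) (fun=> @segment_compact R 0 1).
move=> /compact_near_coveringP.
move=> /(_ _ \oo (fun N v => exists l, forall w : 'rV[R]_#|{: I}|,
      (forall i, `|v ord0 i - w ord0 i| <= c / N.+1%:R) -> U l (par w)) _) [].
  move=> v0 _; have : setT (par v0) by [].
  rewrite -cU => -[l _ Ul].
  have : nbhs v0 (fun v => U l (par v)).
    by apply: par_cont; apply: open_nbhs_nbhs; split.
  move=> /nbhs_ballP[e /= e0 he].
  have ec : 0 < e / 2 / c by rewrite !divr_gt0.
  exists (ball v0 (e / 2), [set N | N.+1%:R^-1 < e / 2 / c]).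
    split; first by apply: nbhsx_ballx; rewrite divr_gt0.
    exact: (near_infty_natSinv_lt (PosNum ec)).
  move=> [v N] /= [vb Ne]; exists l => w hw; apply: he; split=> // i j.
  rewrite (ord1 i); have vj := vb.2 ord0 j.
  have := ler_normD (v0 ord0 j - v ord0 j) (v ord0 j - w ord0 j); rewrite addrA subrK.
  rewrite /ball /= in vj *; move=> tri; apply: (le_lt_trans tri).
  rewrite (splitr e) ltrD // (le_lt_trans (hw j)) //.
  by rewrite mulrC -ltr_pdivlMr.
move=> N _ hN; exists N => v hv; by apply: (hN N) => //=.
Qed.

Lemma card_cell_idx : #|{: I}| = (#|J|.*2).+1.
Proof. by rewrite card_option card_prod card_bool muln2. Qed.

Lemma convex_dist (a b c d t : R) : 0 <= t <= 1 -> `|a - b| <= d -> `|a - c| <= d ->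
  `|a - (b + t * (c - b))| <= d.
Proof.
move=> /andP[t0 t1] hb hc.
have -> : a - (b + t * (c - b)) = (1 - t) * (a - b) + t * (a - c) by ring.
apply: le_trans (ler_normD _ _) _; rewrite !normrM [`|1 - t|]ger0_norm ?subr_ge0 // [`|t|]ger0_norm //.
rewrite [leRHS](_ : d = (1 - t) * d + t * d); last by ring.
by apply: lerD; apply: ler_wpM2l; rewrite ?subr_ge0.
Qed.

Lemma effl_lower_bound (k : nat) : (2 <= n)%N ->
  secat_cover (fun g : Mamb R (torus R) n => effl_map sK g) (@Mn R (torus R) n) k ->
  (2 * n <= k)%N.
Proof.
move=> hn [U [oU [cU hU]]]; rewrite leqNgt; apply/negP => kn.
have [s hs] := choice hU.
pose m := (#|J|.*2).+1.
have mE : m = (2 * n).-1 by rewrite /m card_ord; lia.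
(* The radius is m + 1 grid steps: m for the neighbourhood in [klein_tucker], one more for the step
   to [shift_at i e q]. *)
have [N hN] := lebesgue_par oU cU (ltr0Sn R m).
(* Doubling makes M even, and the mesh 1/M is at most 1/(N + 1). *)
pose M := (N.+1.*2)%N.
have M0 : (0 < M)%N by [].
have Mev : ~~ odd M by rewrite odd_double.
have j0 : J by apply: (@Ordinal _ 0); lia.
pose cov (l : nat) (p : I -> int) := exists2 i : 'I_k, val i = l & U i (par (vec R M p)).
pose bit (j : J) (l : nat) p : bool := if insub l is Some i then monodromy_bit (s i) j (vec R M p) else false.
(* Off the l-th open set the standard cochain is substituted. Both pieces have the same character
   and [cov] is deck-invariant, so the patched function has that character as well. *)
pose h (j : J) (l : nat) (p : I -> int) : bool :=
  if `[< cov l p >] then bit j l p else std_cochain M j p.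
have bitE j (i : 'I_k) p : bit j i p = monodromy_bit (s i) j (vec R M p).
  by rewrite /bit insubT // => lti; rewrite (_ : Sub _ _ = i) //; apply/val_inj.
have hU' j (i : 'I_k) p : U i (par (vec R M p)) -> h j i p = monodromy_bit (s i) j (vec R M p).
  by move=> Ui; rewrite /h; case: asboolP => [_|[]]; [exact: bitE|exists i].
apply: (@klein_tucker J M Mev M0 j0 h).
  move=> j l; exists (fun i => (i == cr J) || (i == ct j)).
  split=> i p; first exact: std_cochain_deck.
  have covE : cov l (deck M (@klein_refl J) i p) = cov l p.
    by rewrite /cov; congr ex2; apply/funext => l'; rewrite par_deck.
  rewrite /h covE; case: asboolP => [[i' <- Ui']|_]; last exact: std_cochain_deck.
  by rewrite !bitE; exact: (monodromy_bit_deck (hs i').2).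
move=> x; pose v := vec R M (@box_pt I M x).
have MR : 0 < M%:R :> R by rewrite ltr0n.
have [i|l hl] := hN v.
  rewrite mxE /box_pt; have := ltn_ord (x (enum_val i)).
  set a := nat_of_ord _ => aM; apply/andP; split; first by rewrite divr_ge0.
  by rewrite ler_pdivrMr // mul1r -[_%:~R]/(a%:R) ler_nat ltnW.
(* As k < 2n, the index satisfies l < 2n - 1 = m, so every open set has its factor. *)
exists l; first by rewrite -/m mE; have := ltn_ord l; move: kn; lia.
move=> j q hq i e e1.
have near_vec (q' : I -> int) (i' : 'I_#|{: I}|) :
    `|q' (enum_val i') - @box_pt I M x (enum_val i')| <= m.+1%:Z ->
    `|v ord0 i' - vec R M q' ord0 i'| <= m.+1%:R / N.+1%:R.
  move=> hq'; rewrite !mxE -mulrBl normrM [`|M%:R^-1|]gtr0_norm ?invr_gt0 //.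
  rewrite -rmorphB /= -intr_norm distrC.
  apply: ler_pM; rewrite ?invr_ge0 ?ler0n ?ler0z //.
    by rewrite -[m.+1%:R]/(m.+1%:Z%:~R) ler_int.
  by rewrite lef_pV2 ?posrE ?ltr0n // ler_nat /M -addnn leq_addr.
have nq i' : `|v ord0 i' - vec R M q ord0 i'| <= m.+1%:R / N.+1%:R.
  by apply: near_vec; apply: le_trans (hq _) _; rewrite lez_nat.
have nq' i' : `|v ord0 i' - vec R M (shift_at i e q) ord0 i'| <= m.+1%:R / N.+1%:R.
  apply: near_vec; rewrite /shift_at; have := hq (enum_val i').
  rewrite -/m => hm; case: ifP => _; last first.
    by rewrite addr0; apply: le_trans hm _; rewrite lez_nat.
  by rewrite addrAC; apply: le_trans (ler_normD _ _) _; rewrite e1 -addn1 PoszD lerD2r.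
have seg t : 0 <= t <= 1 ->
    U l (par (vec R M q + t *: (vec R M (shift_at i e q) - vec R M q))).
  move=> t01; apply: hl => i'.
  have -> : (vec R M q + t *: (vec R M (shift_at i e q) - vec R M q)) ord0 i' =
      vec R M q ord0 i' + t * (vec R M (shift_at i e q) ord0 i' - vec R M q ord0 i').
    by rewrite !mxE.
  by apply: convex_dist => //; [exact: nq|exact: nq'].
rewrite !hU'.
  by symmetry; apply: (monodromy_bit_segment (oU l) (hs l).1 (hs l).2).
  by have := seg 0 ltac:(by rewrite lexx ler01); rewrite scale0r addr0.
have := seg 1 ltac:(by rewrite lexx ler01).
by rewrite scale1r [_ + (_ - _)]addrC subrK.
Qed.

End LowerBound.

(** * Upper bound *)

Section UpperBound.
Variable R : realType.
Let sK := @sigma_antK R.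

Definition normalize (v : R * R) : R * R :=
  let d := v.1 ^+ 2 + v.2 ^+ 2 in
  if d == 0 then (1, 0) else (v.1 / Num.sqrt d, v.2 / Num.sqrt d).

Lemma S1_normalize v : S1 (normalize v).
Proof.
rewrite /S1 /normalize /=; case: eqP => [_|/eqP d0] /=; first by rewrite expr1n expr0n addr0.
by rewrite !expr_div_n sqr_sqrtr ?addr_ge0 ?sqr_ge0 // -mulrDl divff.
Qed.

Lemma normalize_id v : S1 v -> normalize v = v.
Proof.
by case: v => a b; rewrite /S1 /normalize /= => ->; rewrite oner_eq0 sqrtr1 !divr1.
Qed.

Lemma normalize_cont (T : topologicalType) (f : T -> (R * R)%type) x :
  {for x, continuous f} -> (f x).1 ^+ 2 + (f x).2 ^+ 2 != 0 ->
  {for x, continuous (fun t => normalize (f t))}.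
Proof.
move=> cf d0; have f1 := cont_fst cf; have f2 := cont_snd cf.
pose d t := (f t).1 ^+ 2 + (f t).2 ^+ 2.
have cd : {for x, continuous d} := contD (contM f1 f1) (contM f2 f2).
have cs := cont_sqrt cd.
have s0 : Num.sqrt (d x) != 0.
  by rewrite gt_eqF // sqrtr_gt0 lt_neqAle eq_sym d0 addr_ge0 // sqr_ge0.
apply: (@cont_near_eq _ _ _ (fun t => ((f t).1 / Num.sqrt (d t), (f t).2 / Num.sqrt (d t)))).
  have : \forall t \near x, 0 < d t.
    by apply: (cvgr_gt _ cd); rewrite lt_neqAle eq_sym d0 addr_ge0 // sqr_ge0.
  by apply: filterS => t dt; rewrite /normalize -/(d t) gt_eqF.
have cv : {for x, continuous (fun t => (Num.sqrt (d t))^-1)} :=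
  @contV _ _ (fun t => Num.sqrt (d t)) x s0 cs.
have c1 := contM f1 cv; have c2 := contM f2 cv.
exact: (cont_pair c1 c2).
Qed.

(** The chord from 1 to [u] pushed radially to the circle; for a unit [u] it meets 0 only when u =
    -1. *)
Definition seg (u : R * R) (t : R) : R * R := normalize (1 - t + t * u.1, t * u.2).

Lemma S1_seg u t : S1 (seg u t). Proof. exact: S1_normalize. Qed.

Lemma S1_10 : S1 (1 : R, 0 : R).
Proof. by rewrite /S1 /= expr1n expr0n addr0. Qed.

Lemma seg0 u : seg u 0 = (1, 0).
Proof. by rewrite /seg !mul0r subr0 addr0 normalize_id //; exact: S1_10. Qed.

Lemma seg1 u : S1 u -> seg u 1 = u.
Proof. by move=> Su; rewrite /seg subrr add0r !mul1r normalize_id; case: u Su. Qed.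

Lemma seg_cont (T : topologicalType) (u : T -> (R * R)%type) (t : T -> R) x :
  {for x, continuous u} -> {for x, continuous t} ->
  S1 (u x) -> -1 < (u x).1 -> 0 <= t x <= 1 ->
  {for x, continuous (fun y => seg (u y) (t y))}.
Proof.
move=> cu ct; rewrite /S1 /= => Su u1 /andP[t0 t1].
apply: normalize_cont.
  have c1 : {for x, continuous (fun y => 1 - t y)} by apply: contB => //; exact: cont_cst.
  have cu1 := contM ct (cont_fst cu); have cu2 := contM ct (cont_snd cu).
  exact: (cont_pair (contD c1 cu1) cu2).
rewrite /=; move: (u x) (t x) Su u1 t0 t1 => [a b] s /= Su u1 t0 t1.
have -> : (1 - s + s * a) ^+ 2 + (s * b) ^+ 2 =
   (1 - s) ^+ 2 + 2 * s * (1 - s) * a + s ^+ 2 * (a ^+ 2 + b ^+ 2) by ring.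
rewrite Su gt_eqF //.
(* In this form the squared length of the chord point is visibly positive when a > -1. *)
have -> : (1 - s) ^+ 2 + 2 * s * (1 - s) * a + s ^+ 2 * 1 =
   (1 - 2 * s) ^+ 2 + 2 * (s * (1 - s)) * (1 + a) by ring.
have [->|s0] := eqVneq s 0; first by rewrite !(mul0r, mulr0) subr0 addr0 expr1n ltr01.
have [->|s1] := eqVneq s 1; first by rewrite subrr !(mul0r, mulr0) addr0 mulr1; nra.
have sp : 0 < s by rewrite lt_neqAle eq_sym s0.
have s1p : 0 < 1 - s by rewrite subr_gt0 lt_neqAle s1.
apply: ltr_wpDl; first exact: sqr_ge0.
by rewrite !mulr_gt0 //; lra.
Qed.

(* A path from 1 to [w], continuous in [w] away from -1 or from 1 according to [near1]. *)
Definition arc_path (near1 : bool) (w : R * R) (t : R) : R * R :=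
  if near1 then seg w t else cmul (circ t) (seg (oppc w) t).

Lemma S1_opp (w : R * R) : S1 w -> S1 (oppc w).
Proof. by rewrite /S1 /= !sqrrN. Qed.

Lemma S1_arc e w t : S1 (arc_path e w t).
Proof.
by case: e; [exact: S1_seg|apply: S1_cmul; [exact: S1_circ|exact: S1_seg]].
Qed.

Lemma arc0 e w : arc_path e w 0 = (1, 0).
Proof.
by rewrite /arc_path !seg0 circ0 /cmul /= !(mulr1, mul0r, mulr0) subr0 addr0; case: e.
Qed.

Lemma arc1 e w : S1 w -> arc_path e w 1 = w.
Proof.
move=> Sw; rewrite /arc_path !seg1 //; last exact: S1_opp.
case: e => //; case: w {Sw} => a b; rewrite circ1 /cmul /oppc /=; congr pair; ring.
Qed.

Lemma arc_cont_at e (T : topologicalType) (w : T -> (R * R)%type) (t : T -> R) x :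
  {for x, continuous w} -> {for x, continuous t} ->
  S1 (w x) -> (if e then -1 < (w x).1 else (w x).1 < 1) -> 0 <= t x <= 1 ->
  {for x, continuous (fun y => arc_path e (w y) (t y))}.
Proof.
move=> cw ct Sw; rewrite /arc_path; case: e => hw ht; first exact: seg_cont.
apply: cont_cmul; first by apply: (continuous_comp ct); exact: circ_cont.
apply: seg_cont => //; last 2 first.
- exact: S1_opp.
- by rewrite /= ltrN2.
exact: (cont_pair (contN (cont_fst cw)) (contN (cont_snd cw))).
Qed.

Lemma path_curry_cont (T X : topologicalType) (F : T -> pathsp R X) x :
  (forall t, {for (x, t), continuous (fun p : T * II R => (F p.1 : II R -> X) p.2)}) ->
  {for x, continuous F}.
Proof.
move=> h; apply/compact_open_cvgP => K B cK oB FK.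
suff : \forall y \near x, K `<=` [set t | B ((F y : II R -> X) t)].
  by apply: filterS => y hy _ [t Kt <-]; exact: hy.
move/compact_near_coveringP : cK => /(_ _ (nbhs x) (fun y t => B ((F y : II R -> X) t)) _).
apply=> t Kt.
have : nbhs (x, t) ((fun p : T * II R => (F p.1 : II R -> X) p.2) @^-1` B).
  by apply: h; apply: open_nbhs_nbhs; split=> //=; apply: FK; exists t.
move=> [[A1 A2] /= [A1x A2t] AB]; exists (A2, A1); first by split.
by move=> [t' y] /= [A2t' A1y]; exact: (AB (y, t')).
Qed.

Section OrbitNear.
Variables (T : topologicalType) (q : T -> orbsp sK) (t0 : T).
Hypothesis cq : {for t0, continuous q}.

Lemma sigma_ant_cont : continuous (@sigma_ant R).
Proof.
apply: continuous_forall => x.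
have cx : {for x, continuous (fun y : torus R => y)} by exact: cvg_id.
have c1 := torus_cont_fst cx; have c2 := torus_cont_snd cx.
apply: torus_cont.
  exact: (cont_pair (contN (cont_fst c1)) (contN (cont_snd c1))).
exact: (cont_pair (cont_fst c2) (contN (cont_snd c2))).
Qed.

(** The projection is open: the preimage of the image of [B] is [B] together with its translate by
    [sigma_ant]. *)
Lemma orbit_near y0 A : q t0 = Defs.proj sK y0 -> nbhs y0 A ->
  \forall t \near t0, exists2 y, A y & Defs.proj sK y = q t.
Proof.
move=> qt0; rewrite nbhsE => -[B [oB By0] BA].
suff oP : open (Defs.proj sK @` B).
  have : nbhs t0 (q @^-1` (Defs.proj sK @` B)).
    by apply: cq; rewrite qt0; apply: open_nbhs_nbhs; split=> //; exists y0.
  by apply: filterS => t [y By yq]; exists y => //; exact: BA.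
rewrite /open /= /quotient_open.
have -> : \pi_(orbsp sK) @^-1` (Defs.proj sK @` B) = B `|` (@sigma_ant R @^-1` B).
  apply/seteqP; split=> [y [z Bz]|y [By|By]] /=; last 2 first.
  - by exists y.
  - by exists (sigma_ant y) => //; exact: proj_sigma.
  move=> /proj_eq[->|->]; [by left|right].
  by rewrite /= (@sigma_antK R).
apply: openU => //; apply: open_comp => // y _; exact: sigma_ant_cont.
Qed.

(** [repr] is an arbitrary choice, but an invariant [f] takes the same value at the nearby lifts
    given by [orbit_near]. *)
Lemma orbit_fun_cont (f : T -> torus R -> R) y0 :
  q t0 = Defs.proj sK y0 ->
  (forall t y, f t (sigma_ant y) = f t y) ->
  {for (t0, y0), continuous (fun p => f p.1 p.2)} ->
  {for t0, continuous (fun t => f t (repr (q t)))}.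
Proof.
move=> qt0 fs cf.
have fE t y : Defs.proj sK y = q t -> f t (repr (q t)) = f t y.
  move=> yq; have : Defs.proj sK y = Defs.proj sK (repr (q t)).
    by rewrite yq /Defs.proj reprK.
  by move=> /proj_eq[->|->].
move=> A; rewrite (fE t0 y0) // => nA; have [[A1 A2] /= [A1t A2y] hA] := cf _ nA.
have := orbit_near qt0 A2y; apply: filterS2 A1t => t A1t [y A2y' yq].
by rewrite /= (fE _ _ yq); exact: (hA (t, y)).
Qed.

Variable side : T -> torus R -> R.
Hypothesis side_sigma : forall t y, side t (sigma_ant y) = - side t y.

(** A function that changes sign under [sigma_ant] selects one point of an orbit; the default is
    taken where it vanishes on the orbit. *)
Definition side_lift (t : T) : torus R :=
  xget (tp 0 0) [set y | Defs.proj sK y = q t /\ 0 < side t y].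

Lemma side_liftE t y : Defs.proj sK y = q t -> 0 < side t y -> side_lift t = y.
Proof.
move=> yq sy; rewrite /side_lift; case: xgetP => [z _ [zq sz]|/(_ y)[]//].
have : Defs.proj sK y = Defs.proj sK z by rewrite yq zq.
by move=> /proj_eq[//|zE]; exfalso; move: sz; rewrite zE side_sigma; lra.
Qed.

Lemma side_lift_cont y0 : Defs.proj sK y0 = q t0 -> 0 < side t0 y0 ->
  {for (t0, y0), continuous (fun p => side p.1 p.2)} ->
  {for t0, continuous side_lift}.
Proof.
move=> yq sy cs A; rewrite (side_liftE yq sy) => nA.
have [[A1 A2] /= [A1t A2y] hA] : nbhs (t0, y0) [set p | 0 < side p.1 p.2].
  exact: (cvgr_gt _ cs).
have nA1 : nbhs t0 A1 := A1t; have nA2 : nbhs y0 A2 := A2y.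
have n2 : nbhs y0 (A2 `&` A) by apply: filterI.
have nb := orbit_near (esym yq) n2.
change (nbhs t0 (side_lift @^-1` A)); near=> t.
have [y [A2y' Ay] yq'] : exists2 y, (A2 `&` A) y & Defs.proj sK y = q t by near: t.
have A1t' : A1 t by near: t.
by rewrite /= (side_liftE yq' (hA (t, y) (conj A1t' A2y'))).
Unshelve. all: by end_near. Qed.

End OrbitNear.
End UpperBound.

(** * Strata of the seams and their sections *)

Section CoverConstruction.
Variables (R : realType) (n : nat).
Let sK := @sigma_antK R.
Let J : finType := 'I_n.-1.
Let I := cell_idx J.
Let B := Mbase sK n.

Definition rel_angle (x y : torus R) : R * R := cmul (conjc (val x).1) (val y).1.

Lemma S1_rel_angle x y : S1 (rel_angle x y).
Proof. by apply: S1_cmul; [apply: S1_conj; exact: S1_fst|exact: S1_fst]. Qed.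

Lemma rel_angle_sigma x y : rel_angle x (sigma_ant y) = oppc (rel_angle x y).
Proof. by rewrite /rel_angle /cmul /oppc /=; congr pair; ring. Qed.

(** Each value vanishes exactly on its seam and does not depend on [repr]; the square removes the
    sign ambiguity of y'. *)
Definition seam_dist (b : B) (i : I) : R :=
  match i with
  | None => 1 - (val b.1).2.1
  | Some (j, false) => (rel_angle b.1 (repr (b.2 j))).2 ^+ 2
  | Some (j, true) => 1 - (val (repr (b.2 j))).2.1
  end.

(** The largest value of [seam_dist], reached where the choice made near the seam breaks down: x'' =
    -1, y'' = -1, or y' = +-i x'. *)
Definition seam_width (i : I) : R := if i is Some (_, false) then 1 else 2.

Lemma S1_bounds (z : R * R) : S1 z -> -1 <= z.1 <= 1.
Proof. by rewrite /S1 /= => h; apply/andP; split; nra. Qed.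

Lemma S1_gtN1_im (z : R * R) : S1 z -> 0 < z.2 -> -1 < z.1.
Proof.
move=> Sz z2; apply: S1_gtN1 => // e.
by move: z2; rewrite e /= oppr0 ltxx.
Qed.

Lemma seam_dist_ge0 b i : 0 <= seam_dist b i.
Proof.
case: i => [[j []]|] /=; rewrite ?sqr_ge0 //.
  by have /andP[_] := S1_bounds (S1_snd (repr (b.2 j))); lra.
by have /andP[_] := S1_bounds (S1_snd b.1); lra.
Qed.

Lemma base_fst_cont : continuous (fun b : B => b.1).
Proof. by move=> b; exact: cvg_fst. Qed.

Lemma base_snd_cont j : continuous (fun b : B => b.2 j).
Proof.
apply: continuous_forall => b.
apply: (@continuous_comp _ _ _ (fun b : B => b.2) (fun f => f j)); first exact: cvg_snd.
exact: (@proj_continuous J (fun=> orbsp sK) j).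
Qed.

Lemma proj_repr (k : orbsp sK) : k = Defs.proj sK (repr k).
Proof. by rewrite /Defs.proj reprK. Qed.

Lemma rel_angle_cont (b : B) (y : torus R) :
  {for (b, y), continuous (fun p : B * torus R => rel_angle p.1.1 p.2)}.
Proof.
have c1 : {for (b, y), continuous (fun p : B * torus R => p.1.1)}.
  apply: (@continuous_comp _ _ _ (fun p : B * torus R => p.1) (fun b : B => b.1)).
    exact: cvg_fst.
  exact: base_fst_cont.
have c2 : {for (b, y), continuous (fun p : B * torus R => p.2)} by exact: cvg_snd.
exact: (cont_cmul (cont_conj (torus_cont_fst c1)) (torus_cont_fst c2)).
Qed.

Lemma seam_dist_cont i : continuous (fun b => seam_dist b i).
Proof.
apply: continuous_forall => b.
have cb : {for b, continuous (fun b : B => b.1)} by exact: base_fst_cont.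
case: i => [[j []]|] /=.
- apply: (@orbit_fun_cont _ _ (fun b : B => b.2 j) b _ (fun _ y => 1 - (val y).2.1) (repr (b.2 j))) => //.
  + exact: base_snd_cont.
  + exact: proj_repr.
  + have c2 : {for (b, repr (b.2 j)), continuous (fun p : B * torus R => p.2)} by exact: cvg_snd.
    by apply: contB; [exact: cont_cst|exact: cont_fst (torus_cont_snd c2)].
- apply: (@orbit_fun_cont _ _ (fun b : B => b.2 j) b _ (fun b y => (rel_angle b.1 y).2 ^+ 2) (repr (b.2 j))) => //.
  + exact: base_snd_cont.
  + exact: proj_repr.
  + by move=> t y; rewrite rel_angle_sigma /= sqrrN.
  + have c := cont_snd (@rel_angle_cont b (repr (b.2 j))).
    exact: (contM c c).
- have c1 : {for b, continuous (fun b : B => 1 : R)} by exact: cont_cst.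
  exact: (contB c1 (cont_fst (torus_cont_snd cb))).
Qed.

Definition stratum (S : {set I}) : set B := [set b | [/\
  forall i, i \in S -> seam_dist b i < seam_width i,
  forall i, i \notin S -> 0 < seam_dist b i &
  forall i k, i \in S -> k \notin S -> seam_dist b i < seam_dist b k]].

Lemma stratum_open S : open (stratum S).
Proof.
rewrite openE => b [h1 h2 h3].
have c i : {for b, continuous (fun b => seam_dist b i)} by exact: seam_dist_cont.
have n1 : \forall b' \near b, forall i, i \in S -> seam_dist b' i < seam_width i.
  apply: (@filter_forall B (cell_idx J) (fun i b' => i \in S -> seam_dist b' i < seam_width i) (nbhs b) _) => i.
  case: (boolP (i \in S)) => iS; last exact: nearW.
  have h : \forall b' \near b, seam_dist b' i < seam_width i := cvgr_lt _ (c i) _ (h1 i iS).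
  near=> b'; move=> _; near: b'; exact: h.
have n2 : \forall b' \near b, forall i, i \notin S -> 0 < seam_dist b' i.
  apply: (@filter_forall B (cell_idx J) (fun i b' => i \notin S -> 0 < seam_dist b' i) (nbhs b) _) => i.
  case: (boolP (i \notin S)) => iS; last exact: nearW.
  have h : \forall b' \near b, 0 < seam_dist b' i := cvgr_gt _ (c i) _ (h2 i iS).
  near=> b'; move=> _; near: b'; exact: h.
have n3 : \forall b' \near b, forall i k, i \in S -> k \notin S -> seam_dist b' i < seam_dist b' k.
  apply: (@filter_forall B (cell_idx J) (fun i b' => forall k, i \in S -> k \notin S ->
    seam_dist b' i < seam_dist b' k) (nbhs b) _) => i.
  apply: (@filter_forall B (cell_idx J) (fun k b' => i \in S -> k \notin S ->
    seam_dist b' i < seam_dist b' k) (nbhs b) _) => k.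
  case: (boolP ((i \in S) && (k \notin S))) => [/andP[iS kS]|nS]; last first.
    by apply: nearW => b' iS kS; rewrite iS kS in nS.
  have cc : {for b, continuous (fun b => seam_dist b k - seam_dist b i)} by exact: contB.
  have h : \forall b' \near b, 0 < seam_dist b' k - seam_dist b' i.
    by apply: (cvgr_gt _ cc); rewrite subr_gt0; exact: h3.
  near=> b'; move=> _ _; rewrite -subr_gt0; near: b'; exact: h.
by near=> b'; split; near: b'.
Unshelve. all: by end_near. Qed.

(** Distinct sets of equal size are incomparable, and an i in S but not S' with a k in S' but not S
    would satisfy opposite strict inequalities. *)
Lemma stratum_uniq (S S' : {set I}) (b : B) : #|S| = #|S'| -> stratum S b -> stratum S' b -> S = S'.
Proof.
move=> cS [_ _ h] [_ _ h'].
case: (boolP (S \subset S')) => [sS|/subsetPn[i iS iS']].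
  by apply/eqP; rewrite eqEcard sS cS leqnn.
case: (boolP (S' \subset S)) => [sS|/subsetPn[k kS kS']].
  by apply/esym/eqP; rewrite eqEcard sS cS leqnn.
by have := lt_trans (h i k iS kS') (h' k i kS iS'); rewrite ltxx.
Qed.

(** Near the seam x' = +-y' the lift with y' / x' in the right half-plane is taken, away from it the
    one in the upper half-plane; in both cases y' / x' avoids -1, as [seg] requires. *)
Definition side (S : {set I}) (j : J) (b : B) (y : torus R) : R :=
  if cs j \in S then (rel_angle b.1 y).1 else (rel_angle b.1 y).2.

Definition end_lift (S : {set I}) (j : J) (b : B) : torus R :=
  side_lift (fun b : B => b.2 j) (side S j) b.

Lemma side_sigma S j b y : side S j b (sigma_ant y) = - side S j b y.
Proof. by rewrite /side rel_angle_sigma; case: ifP. Qed.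

Lemma end_lift_spec (S : {set I}) j (b : B) : stratum S b ->
  [/\ Defs.proj sK (end_lift S j b) = b.2 j, 0 < side S j b (end_lift S j b) &
      {for b, continuous (end_lift S j)}].
Proof.
move=> [h1 h2 h3]; set y0 := repr (b.2 j).
have s0 : side S j b y0 != 0.
  rewrite /side; case: (boolP (cs j \in S)) => hj.
    have := h1 _ hj; rewrite /= -/y0; have := S1_rel_angle b.1 y0; rewrite /S1 /= => e lt1.
    by apply/eqP => z; move: e; rewrite z expr0n /= add0r => e; move: lt1; rewrite e ltxx.
  by have := h2 _ hj; rewrite /= -/y0; apply: contraTneq => ->; rewrite expr0n ltxx.
have [y [yq ys]] : exists y, Defs.proj sK y = b.2 j /\ 0 < side S j b y.
  move: s0; rewrite neq_lt => /orP[lt0|gt0]; last by exists y0; rewrite -proj_repr.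
  by exists (sigma_ant y0); rewrite proj_sigma -proj_repr side_sigma oppr_gt0.
have yE := @side_liftE R B (fun b : B => b.2 j) (side S j) (side_sigma S j) b y yq ys.
rewrite /end_lift yE; split=> //.
apply: (@side_lift_cont R B (fun b : B => b.2 j) b _ (side S j) (side_sigma S j) y yq ys); first exact: base_snd_cont.
have c := @rel_angle_cont b y.
by rewrite /side; case: (cs j \in S); [exact: cont_fst c|exact: cont_snd c].
Qed.

(** Only x'' moves, starting from 1; [end_path] likewise begins at (x', 1), which is the common
    starting point. *)
Definition start_path (S : {set I}) (b : B) : pathsp R (torus R) :=
  fun t => mkT (S1_fst b.1) (S1_arc (cr J \in S) (val b.1).2 (val t)).

Definition end_path (S : {set I}) (j : J) (b : B) : pathsp R (torus R) :=
  fun t => mkT (S1_cmul (S1_fst b.1) (S1_seg (rel_angle b.1 (end_lift S j b)) (val t)))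
    (S1_arc (ct j \in S) (val (end_lift S j b)).2 (val t)).

Definition stratum_section (S : {set I}) (b : B) : Mamb R (torus R) n :=
  (start_path S b, fun j => end_path S j b).

Lemma val_II_itv (t : II R) : 0 <= val t <= 1.
Proof. exact: set_mem (valP t). Qed.

Section AtPoint.
Variables (S : {set I}) (b : B).
Hypothesis Sb : stratum S b.

Lemma start_path_joint t : {for (b, t), continuous (fun p : B * II R => (start_path S p.1 : II R -> torus R) p.2)}.
Proof.
have [h1 h2 _] := Sb.
have c1 : {for (b, t), continuous (fun p : B * II R => p.1.1)}.
  apply: (@continuous_comp _ _ _ (fun p : B * II R => p.1) (fun b : B => b.1)).
    exact: cvg_fst.
  exact: base_fst_cont.
have c2 : {for (b, t), continuous (fun p : B * II R => val p.2)}.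
  apply: (@continuous_comp _ _ _ (fun p : B * II R => p.2) val); first exact: cvg_snd.
  exact: initial_continuous.
have hw : if cr J \in S then -1 < (val b.1).2.1 else (val b.1).2.1 < 1.
  case: (boolP (cr J \in S)) => hS; first by have := h1 _ hS; rewrite /=; lra.
  by have := h2 _ hS; rewrite /=; lra.
apply: torus_cont; first exact: (torus_cont_fst c1).
exact: (@arc_cont_at R (cr J \in S) (B * II R)%type (fun p => (val p.1.1).2)
  (fun p => val p.2) (b, t) (torus_cont_snd c1) c2 (S1_snd b.1) hw (val_II_itv t)).
Qed.

Lemma end_path_joint j t : {for (b, t), continuous (fun p : B * II R => (end_path S j p.1 : II R -> torus R) p.2)}.
Proof.
have [h1 h2 _] := Sb; have [yq ys yc] := end_lift_spec j Sb.
have cb : {for (b, t), continuous (fun p : B * II R => p.1)} by exact: cvg_fst.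
have c1 : {for (b, t), continuous (fun p : B * II R => p.1.1)}.
  by apply: (@continuous_comp _ _ _ (fun p : B * II R => p.1) (fun b : B => b.1)); last exact: base_fst_cont.
have c2 : {for (b, t), continuous (fun p : B * II R => val p.2)}.
  apply: (@continuous_comp _ _ _ (fun p : B * II R => p.2) val); first exact: cvg_snd.
  exact: initial_continuous.
have cy : {for (b, t), continuous (fun p : B * II R => end_lift S j p.1)}.
  exact: (@continuous_comp _ _ _ (fun p : B * II R => p.1) (end_lift S j)).
have cz := torus_cont_fst c1.
have u1 : -1 < (rel_angle b.1 (end_lift S j b)).1.
  move: ys; rewrite /side; case: ifP => _ up; last exact: S1_gtN1_im (S1_rel_angle _ _) up.
  by apply: lt_trans up; exact: ltrN10.
have yE : (val (repr (b.2 j))).2.1 = (val (end_lift S j b)).2.1.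
  by have := proj_repr (b.2 j); rewrite -{1}yq => /proj_eq[<-|->].
have hw : if ct j \in S then -1 < (val (end_lift S j b)).2.1 else (val (end_lift S j b)).2.1 < 1.
  case: (boolP (ct j \in S)) => hS; first by have := h1 _ hS; rewrite /= yE; lra.
  by have := h2 _ hS; rewrite /= yE; lra.
have cu := cont_cmul (cont_conj cz) (torus_cont_fst cy).
apply: torus_cont.
  apply: (cont_cmul cz).
  exact: (@seg_cont R (B * II R)%type (fun p => rel_angle p.1.1 (end_lift S j p.1))
    (fun p => val p.2) (b, t) cu c2 (S1_rel_angle _ _) u1 (val_II_itv t)).
exact: (@arc_cont_at R (ct j \in S) (B * II R)%type (fun p => (val (end_lift S j p.1)).2)
  (fun p => val p.2) (b, t) (torus_cont_snd cy) c2 (S1_snd _) hw (val_II_itv t)).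
Qed.

Lemma path_of_joint (F : B -> pathsp R (torus R)) :
  (forall t, {for (b, t), continuous (fun p : B * II R => (F p.1 : II R -> torus R) p.2)}) ->
  continuous (F b : II R -> torus R).
Proof.
move=> h t.
apply: (@continuous_comp _ _ _ (fun t : II R => (b, t)) (fun p : B * II R => (F p.1 : II R -> torus R) p.2)).
  exact: (@cvg_pair _ _ _ (nbhs t) (nbhs b) (nbhs t) _ _ _ (fun=> b) id (cvg_cst _) cvg_id).
exact: h.
Qed.

Lemma stratum_section_cont : {for b, continuous (stratum_section S)}.
Proof.
have h1 : {for b, continuous (start_path S)} := path_curry_cont start_path_joint.
have h2 : {for b, continuous (fun b => (fun j => end_path S j b) : {ptws J -> pathsp R (torus R)})}.
  apply: (@ptws_cont J B (pathsp R (torus R)) (fun b j => end_path S j b) b) => j.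
  exact: (@path_curry_cont R B (torus R) (end_path S j) b (@end_path_joint j)).
exact: (@cvg_pair _ _ _ (nbhs b) (nbhs (stratum_section S b).1) (nbhs (stratum_section S b).2) _ _ _ _ _ h1 h2).
Qed.

Lemma stratum_section_spec :
  @Mn R (torus R) n (stratum_section S b) /\ effl_map sK (stratum_section S b) = b.
Proof.
split; first split; [|split|].
- exact: path_of_joint start_path_joint.
- by move=> j; exact: path_of_joint (@end_path_joint j).
- move=> j; apply: torus_eq => /=; last by rewrite !arc0.
  by rewrite seg0; case: (val b.1).1 => ? ?; rewrite /cmul /= !(mulr1, mulr0) subr0 add0r.
rewrite /effl_map; case: b Sb => x k Sxk; congr pair.
  by apply: torus_eq => //=; rewrite arc1 //; exact: S1_snd.
apply/funext => j; have [yq _ _] := end_lift_spec j Sxk; rewrite -[RHS]yq.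
congr Defs.proj; apply: torus_eq => /=; last by rewrite arc1 //; exact: S1_snd.
by rewrite seg1; [rewrite cmulVK //; exact: S1_fst|exact: S1_rel_angle].
Qed.

End AtPoint.

Lemma effl_upper_bound : (2 <= n)%N ->
  secat_cover (fun g : Mamb R (torus R) n => effl_map sK g) (@Mn R (torus R) n) (2 * n).
Proof.
move=> hn; have cI : #|{: I}|.+1 = (2 * n)%N.
  by rewrite card_cell_idx card_ord; lia.
(* On the union of the strata of size l the set S is recovered from the point and is locally
   constant, so the sections over the strata glue. *)
pose sel (l : nat) (b : B) : {set I} := xget (finset.set0 : {set I}) [set S : {set I} | #|S| = l /\ stratum S b].
have selE S b : stratum S b -> sel #|S| b = S.
  move=> Sb; rewrite /sel; case: xgetP => [S' _ [cS' S'b]|/(_ S)[]//].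
  exact: stratum_uniq cS' S'b Sb.
exists (fun l => \bigcup_(S in [set S : {set I} | #|S| = l :> nat]) stratum S); split; [|split].
- by move=> l; apply: bigcup_open => S _; exact: stratum_open.
(* A point lies in the stratum of the seams that contain it; the sizes 0 to 2n - 1 give the 2n open
   sets. *)
- apply/seteqP; split=> // b _; pose S : {set I} := finset.finset (fun i => seam_dist b i == 0).
  have cS : (#|S| < 2 * n)%N by rewrite -cI ltnS max_card.
  exists (Ordinal cS) => //; exists S => //; split=> [i|i|i k]; rewrite !inE.
  + by move=> /eqP ->; rewrite /seam_width; case: i => [[j []]|]; rewrite ?ltr01 ?ltr0n.
  + by move=> d0; rewrite lt_neqAle eq_sym d0 seam_dist_ge0.
  + by move=> /eqP -> d0; rewrite lt_neqAle eq_sym d0 seam_dist_ge0.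
move=> l; exists (fun b => stratum_section (sel l b) b); split; last first.
  by move=> b [S /= <- Sb]; rewrite selE //; exact: stratum_section_spec.
rewrite continuous_open_subspace; last first.
  by apply: bigcup_open => S _; exact: stratum_open.
move=> b; rewrite inE => -[S /= lS Sb].
apply: (@cont_near_eq _ _ _ (stratum_section S)); last exact: stratum_section_cont.
have : nbhs b (stratum S) by apply: open_nbhs_nbhs; split=> //; exact: stratum_open.
by apply: filterS => b' Sb'; rewrite -lS selE.
Qed.

End CoverConstruction.

Theorem mainTheorem16 (R : realType) (n : nat) (hn : (2 <= n)%N) :
  @TC_effl_is R (torus R) (@sigma_ant R) (@sigma_antK R) n (2 * n).
Proof.
by split; [exact: effl_upper_bound|move=> k; exact: effl_lower_bound].
Qed.
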